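(* Let $\nu$ be a measure for $\mathfrak{P}$ (the class of finite posets) valued in a field $k$, and let $\nu_{p,q}=\nu(J_{p,q},\ast)$ for $p,q\ge0$. (a) We have $\nu_{p,q}=\nu_{\overline{p},\overline{q}}$ for all $p,q \ge 0$, where $\overline{n}=\min(n,2)$. Consequently, $\nu$ is completely determined by the $3\times3$ matrix $N=(\nu_{p,q})_{0\le p,q\le2}$. (b) The matrix $N$ belongs to the 2-parameter family $\mathbb{A}$, or to one of the eight 1-parameter families $\mathbb{B}_i$ or $\mathbb{B}_i^{\top}$ ($1\le i\le5$), or is one of the 15 matrices $\mathbb{C}_i$ or $\mathbb{C}_i^{\top}$ ($1\le i\le8$), where these families and matrices are listed in the context (parameters $s,t$ range over $k$).
   Context: All posets are finite; the empty poset is allowed. An embedding of posets is an injective map $\alpha\colon P\to Q$ with $x\le y\iff\alpha(x)\le\alpha(y)$. Given embeddings $\alpha\colon P\to Q$ and $\beta\colon P\to P'$, an amalgamation of $Q$ and $P'$ over $P$ is a triple $(Q',\alpha',\beta')$ where $Q'$ is a poset and $\alpha'\colon P'\to Q'$, $\beta'\colon Q\to Q'$ are embeddings with $\beta'\circ\alpha=\alpha'\circ\beta$ and $Q'=\mathrm{im}(\alpha')\cup\mathrm{im}(\beta')$; amalgamations are considered up to the evident notion of isomorphism. A measure for $\mathfrak{P}$ valued in a commutative ring $k$ is a rule $\nu$ assigning to each embedding $\alpha\colon P\to Q$ of finite posets a value $\nu(\alpha)\in k$ such that: (a) $\nu(\alpha)=1$ if $\alpha$ is an isomorphism; (b) $\nu(\beta\circ\alpha)=\nu(\beta)\nu(\alpha)$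 when the composition is defined; (c) given embeddings $\alpha\colon P\to Q$ and $\beta\colon P\to P'$, with $(Q'_i,\alpha'_i,\beta'_i)$, $1\le i\le r$, the various amalgamations up to isomorphism, $\nu(\alpha)=\sum_{i=1}^r\nu(\alpha'_i)$. A marked poset is a pair $(P,x)$ with $x\in P$; put $P^x=P\setminus\{x\}$ (induced order) and $\nu(P,x)=\nu(P^x\to P)$. $J_{p,q}$ is the poset on $\{a_1,\dots,a_p,\ast,b_1,\dots,b_q\}$ with order generated by $a_i<\ast$ and $\ast<b_j$ for all $i,j$, marked at $\ast$. The matrices (rows and columns indexed by $0,1,2$) are: $$\mathbb{A}(s,t)=\begin{pmatrix}t&0&0\\0&s&s\\0&s&s\end{pmatrix},\ \mathbb{B}_1(t)=\begin{pmatrix}t&t&t\\t&t&t\\t&t&t\end{pmatrix},\ \mathbb{B}_2(t)=\begin{pmatrix}0&t&t\\0&t&t\\0&t&t\end{pmatrix},$$ $$\mathbb{B}_3(t)=\begin{pmatrix}t&0&0\\0&-1&0\\0&-1&0\end{pmatrix},\ \mathbb{B}_4(t)=\begin{pmatrix}t&-1&0\\-1&-1&0\\0&-1&0\end{pmatrix},\ \mathbb{B}_5(t)=\begin{pmatrix}t&-1&0\\-1&-1&0\\0&0&1\end{pmatrix},$$ $$\mathbb{C}_1=\begin{pmatrix}0&-1&0\\0&-1&0\\0&-1&0\end{pmatrix},\ \mathbb{C}_2=\begin{pmatrix}-1&-1&0\\-1&-1&0\\-1&-1&0\end{pmatrix},\ \mathbb{C}_3=\begin{pmatrix}0&0&0\\-1&-1&0\\-1&-1&0\end{pmatrix},\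 \mathbb{C}_4=\begin{pmatrix}0&0&1\\-1&-1&0\\0&-1&0\end{pmatrix},$$ $$\mathbb{C}_5=\begin{pmatrix}0&0&1\\-1&-1&0\\-1&-1&0\end{pmatrix},\ \mathbb{C}_6=\begin{pmatrix}1&0&1\\0&-1&0\\0&-1&0\end{pmatrix},\ \mathbb{C}_7=\begin{pmatrix}0&-1&0\\0&-1&0\\1&0&1\end{pmatrix},\ \mathbb{C}_8=\begin{pmatrix}1&0&1\\0&-1&0\\1&0&1\end{pmatrix}.$$ ($\mathbb{B}_1,\mathbb{B}_5,\mathbb{C}_8$ are symmetric.) *)

(* Defs.v *)
From HB Require Import structures.
From mathcomp Require Import all_boot all_order all_algebra.

Set Implicit Arguments.
Unset Strict Implicit.
Unset Printing Implicit Defensive.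

Import Order.TTheory GRing.Theory.
Local Open Scope ring_scope.

(* All posets share one display, so that they form a single type. *)
Definition poset_display : Order.disp_t := Order.Disp tt tt.
Notation poset := (finPOrderType poset_display).

Definition is_embedding (P Q : poset) (f : {ffun P -> Q}) : bool :=
  injectiveb f && [forall x, forall y, (x <= y)%O == (f x <= f y)%O].

(* Finite functions, so that an embedding is determined by its values. *)
Record embedding (P Q : poset) : Type := Embedding {
  emb_fun :> {ffun P -> Q};
  emb_funP : is_embedding emb_fun
}.

HB.instance Definition _ P Q := [isSub for @emb_fun P Q].
HB.instance Definition _ P Q := [Finite of embedding P Q by <:].

Lemma is_embeddingP (P Q : poset) (f : {ffun P -> Q}) :
  reflect (injective f /\ forall x y, (x <= y)%O = (f x <= f y)%O)
          (is_embedding f).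
Proof.
apply: (iffP andP) => [[/injectiveP fI /'forall_'forall_eqP fM]|[fI fM]].
  by split.
by split; [apply/injectiveP | apply/'forall_'forall_eqP].
Qed.

Lemma emb_inj (P Q : poset) (f : embedding P Q) : injective f.
Proof. by have /is_embeddingP[] := emb_funP f. Qed.

Lemma emb_le (P Q : poset) (f : embedding P Q) x y : (x <= y)%O = (f x <= f y)%O.
Proof. by have /is_embeddingP[_] := emb_funP f. Qed.

Lemma emb_comp_subproof (P Q R : poset)
  (g : embedding Q R) (f : embedding P Q) :
  is_embedding [ffun x => g (f x)].
Proof.
apply/is_embeddingP; split=> [x y|x y]; rewrite !ffunE.
  by move/emb_inj/emb_inj.
by rewrite (emb_le f) (emb_le g).
Qed.

Definition emb_comp (P Q R : poset)
  (g : embedding Q R) (f : embedding P Q) : embedding P R :=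
  Embedding (emb_comp_subproof g f).

Section Amalgamations.

Variables (P Q P' : poset) (a : embedding P Q) (b : embedding P P').

Record amalgamation : Type := Amalgamation {
  am_poset :> poset;
  am_a : embedding P' am_poset;
  am_b : embedding Q am_poset;
  am_comm : forall x, am_b (a x) = am_a (b x);
  am_cover : forall z, z \in codom am_a \/ z \in codom am_b
}.

Definition amalgamation_iso (A B : amalgamation) : Prop :=
  exists f : embedding A B, [/\ bijective f,
    forall y, f (am_a A y) = am_a B y & forall y, f (am_b A y) = am_b B y].

(* A 0, ..., A (r-1) represent each isomorphism class exactly once. *)
Definition all_amalgamations (r : nat) (A : 'I_r -> amalgamation) : Prop :=
  (forall i j, amalgamation_iso (A i) (A j) -> i = j) /\
  (forall B, exists i, amalgamation_iso B (A i)).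

End Amalgamations.

(* An isomorphism of posets is a bijective embedding. *)
Record measure (k : comPzRingType) : Type := Measure {
  measure_fun :> forall P Q : poset, embedding P Q -> k;
  measure_iso : forall (P Q : poset) (a : embedding P Q),
    bijective a -> measure_fun a = 1;
  measure_comp : forall (P Q R : poset) (b : embedding Q R) (a : embedding P Q),
    measure_fun (emb_comp b a) = measure_fun b * measure_fun a;
  measure_amalg : forall (P Q P' : poset) (a : embedding P Q)
      (b : embedding P P') (r : nat) (A : 'I_r -> amalgamation a b),
    all_amalgamations A ->
    measure_fun a = \sum_(i < r) measure_fun (am_a (A i))
}.

Section MarkedPosets.

Variables (P : poset) (x : P).

Definition point_del : Type := {y : P | y != x}.

HB.instance Definition _ := SubFinite.on point_del.
HB.instance Definition _ :=
  [SubChoice_isSubPOrder of point_del by <: with poset_display].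

Lemma point_del_subproof : is_embedding [ffun y : point_del => val y].
Proof.
apply/is_embeddingP; split=> [y z|y z]; rewrite !ffunE; last by rewrite leEsub.
exact: val_inj.
Qed.

Definition point_del_emb : embedding point_del P :=
  Embedding point_del_subproof.

Definition measure_marked (k : comPzRingType) (nu : measure k) : k :=
  nu _ _ point_del_emb.

End MarkedPosets.

(* [Some (inl i)], [None] and [Some (inr j)] stand for a_i, * and b_j. *)
Definition Jposet (p q : nat) : Type := option ('I_p + 'I_q).

HB.instance Definition _ p q := Finite.on (Jposet p q).

Section JOrder.

Variables p q : nat.

Definition Jgen (x y : Jposet p q) : bool :=
  match x, y with
  | Some (inl _), None => true
  | None, Some (inr _) => true
  | _, _ => false
  end.

Definition Jle : rel (Jposet p q) := connect Jgen.

Definition Jlevel (x : Jposet p q) : nat :=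
  match x with Some (inl _) => 0 | None => 1 | Some (inr _) => 2 end.

Lemma JleE x y : Jle x y = (x == y) || (Jlevel x < Jlevel y)%N.
Proof.
apply/idP/orP => [|[/eqP->|]]; last 2 first.
- exact: connect0.
- case: x y => [[i|i]|] [[j|j]|] //= _; try exact: connect1.
  by apply: (@connect_trans _ _ None); apply: connect1.
case/connectP=> s; elim: s x => [|z s IHs] x /= => [_ ->|]; first by left.
case/andP=> xz zs ys; right.
have xzl : (Jlevel x < Jlevel z)%N by case: x z xz {zs ys} => [[?|?]|] [[?|?]|].
case: (IHs z zs ys) => [/eqP<- //|]; exact: ltn_trans.
Qed.

Lemma Jle_refl : reflexive Jle.
Proof. exact: connect0. Qed.

Lemma Jle_anti : antisymmetric Jle.
Proof.
move=> x y; rewrite !JleE eq_sym; case: eqP => //= _ /andP[xy yx].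
by have := ltn_trans xy yx; rewrite ltnn.
Qed.

Lemma Jle_trans : transitive Jle.
Proof. exact: connect_trans. Qed.

HB.instance Definition _ := Order.Le_isPOrder.Build poset_display (Jposet p q)
  Jle_refl Jle_anti Jle_trans.

End JOrder.

Definition nuJ (k : comPzRingType) (nu : measure k) (p q : nat) : k :=
  measure_marked (None : Jposet p q) nu.

Definition nuJ_mx (k : comPzRingType) (nu : measure k) : 'M[k]_3 :=
  \matrix_(p < 3, q < 3) nuJ nu p q.

Section Matrices.

Variable k : fieldType.
Implicit Types s t : k.

Definition mx3 (rows : seq (seq k)) : 'M[k]_3 :=
  \matrix_(i < 3, j < 3) nth 0 (nth [::] rows i) j.

Definition mxA s t := mx3 [:: [:: t; 0; 0]; [:: 0; s; s]; [:: 0; s; s]].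

Definition mxB1 t := mx3 [:: [:: t; t; t]; [:: t; t; t]; [:: t; t; t]].
Definition mxB2 t := mx3 [:: [:: 0; t; t]; [:: 0; t; t]; [:: 0; t; t]].
Definition mxB3 t := mx3 [:: [:: t; 0; 0]; [:: 0; -1; 0]; [:: 0; -1; 0]].
Definition mxB4 t := mx3 [:: [:: t; -1; 0]; [:: -1; -1; 0]; [:: 0; -1; 0]].
Definition mxB5 t := mx3 [:: [:: t; -1; 0]; [:: -1; -1; 0]; [:: 0; 0; 1]].

Definition mxC1 := mx3 [:: [:: 0; -1; 0]; [:: 0; -1; 0]; [:: 0; -1; 0]].
Definition mxC2 := mx3 [:: [:: -1; -1; 0]; [:: -1; -1; 0]; [:: -1; -1; 0]].
Definition mxC3 := mx3 [:: [:: 0; 0; 0]; [:: -1; -1; 0]; [:: -1; -1; 0]].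
Definition mxC4 := mx3 [:: [:: 0; 0; 1]; [:: -1; -1; 0]; [:: 0; -1; 0]].
Definition mxC5 := mx3 [:: [:: 0; 0; 1]; [:: -1; -1; 0]; [:: -1; -1; 0]].
Definition mxC6 := mx3 [:: [:: 1; 0; 1]; [:: 0; -1; 0]; [:: 0; -1; 0]].
Definition mxC7 := mx3 [:: [:: 0; -1; 0]; [:: 0; -1; 0]; [:: 1; 0; 1]].
Definition mxC8 := mx3 [:: [:: 1; 0; 1]; [:: 0; -1; 0]; [:: 1; 0; 1]].

Definition mxBs t := [:: mxB1 t; mxB2 t; mxB3 t; mxB4 t; mxB5 t].
Definition mxCs := [:: mxC1; mxC2; mxC3; mxC4; mxC5; mxC6; mxC7; mxC8].

End Matrices.

Arguments mxCs k : clear implicits.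

(* Main.v *)
From HB Require Import structures.
From mathcomp Require Import all_boot all_order all_algebra.
From mathcomp Require Import ring zify.
Require Import Defs.
Local Open Scope ring_scope.

(** Everything rests on the values of one-point extensions.  Adding a point to a
    poset [A] amounts to choosing a cut: the set [D] of points below it and the
    set [U] of points above it.  Write [v A D U] for the measure of this
    extension.  The axioms of a measure turn into two rules ([valuation]):
    - insertion: amalgamating the extension of [A :\ z] by a point [x] with
      [A] leaves four possible positions of [x] relative to [z] (equal, incomparable,
      above, below), so [v (A :\ z) D U] is a sum of at most four terms;
    - exchange: adding [x] then [y] costs the same as adding [y] then [x].

    By insertion, a point lying strictly under another point of [D] can be
    deleted, and a point incomparable to the new one can be traded for points that are
    comparable to it.  So every value is an integral affine combination of
    the corner values [N p q], where [D] and [U] are antichains of sizes [p]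
    and [q] filling [A] ([val_full], [eval_sound]); this gives uniqueness.

    Stability ([corner_stable]).  Let [p > 2] and suppose that [N j q = N 2 q] for
    all [2 <= j < p].  Consider the poset [crown]: an antichain of points [s_i], [i < p],
    points [z_j], [j < m], with [m < p] and [z_j] above all [s_i] but [s_j], a point [y] above the
    [s_i] and incomparable to the [z_j], a point [x] above all of these, and
    [q] points on top.  Expanding over the incomparable points [z_j] telescopes,
    since the [s_i] together with a nonempty set of [z_j] have at least [2] and fewer
    than [p] maximal elements.  The exchange of [x] and [y] reads
      [N (m+1) q * (N p q - N 2 q) = N 2 q * (N p 1 - N 2 1)].
    The right-hand side does not depend on [m]; comparing [m = 1] with
    [m = p - 1] gives [(N p q - N 2 q)^2 = 0].

    Classification ([classification]).  Exchanges in posets with at most seven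
    elements give quadratic relations between the nine entries; they are computed
    by the verified evaluator [eval].  If [N 1 1 <> -1] they force a matrix of
    type A, B1, B2 or the transpose of B2.  If [N 1 1 = -1] they confine the neighbours of the
    centre to [{0, -1}] and determine the corners up to a few choices. *)

Set Implicit Arguments.
Unset Strict Implicit.
Unset Printing Implicit Defensive.

Import Order.TTheory GRing.Theory.

(** * Cuts *)

Section Cuts.
Variable T : finType.
Implicit Types (r : rel T) (A D U : {set T}).

Definition order_on r A :=
  [/\ {in A, reflexive r}, {in A &, antisymmetric r} & {in A & &, transitive r}].

Definition opp_rel r : rel T := fun x y => r y x.

(** The axioms on [(D, U)] under which a new point may be placed above [D], below
    [U] and incomparable to the rest of [A]; the transitivity through the new
    point is what relates [D] to [U]. *)
Definition cut r A D U :=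
  [&& D :|: U \subset A, [disjoint D & U],
      [forall d in D, forall a in A, r a d ==> (a \in D)],
      [forall u in U, forall a in A, r u a ==> (a \in U)]
    & [forall d in D, forall u in U, r d u]].

Lemma cutP r A D U :
  reflect [/\ D :|: U \subset A, [disjoint D & U],
              forall d a, d \in D -> a \in A -> r a d -> a \in D,
              forall u a, u \in U -> a \in A -> r u a -> a \in U
            & forall d u, d \in D -> u \in U -> r d u]
          (cut r A D U).
Proof.
apply: (iffP and5P) => -[sA dDU dD uU rDU]; split=> //.
- by move=> d a Dd Aa; move/forall_inP/(_ d Dd)/forall_inP/(_ a Aa)/implyP: dD.
- by move=> d a Dd Aa; move/forall_inP/(_ d Dd)/forall_inP/(_ a Aa)/implyP: uU.
- by move=> d u Dd; move/forall_inP/(_ d Dd)/forall_inP: rDU; apply.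
- by apply/forall_inP=> d Dd; apply/forall_inP=> a Aa; apply/implyP; apply: dD.
- by apply/forall_inP=> d Dd; apply/forall_inP=> a Aa; apply/implyP; apply: uU.
- by apply/forall_inP=> d Dd; apply/forall_inP=> a; apply: rDU.
Qed.

Definition below r A x := [set a in A | (a != x) && r a x].
Definition above r A x := [set a in A | (a != x) && r x a].

Definition antichain r A := {in A &, forall x y, r x y -> x = y}.
Definition maxima r A := [set x in A | [forall y in A, r x y ==> (y == x)]].

Lemma order_on_opp r A : order_on r A -> order_on (opp_rel r) A.
Proof.
case=> rr ra rt; split=> // [x y Ax Ay /andP[xy yx]|y x z Ay Ax Az yx zy].
  by apply: ra => //; apply/andP.
exact: rt zy yx.
Qed.

Lemma order_onS r A (B : {set T}) : B \subset A -> order_on r A -> order_on r B.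
Proof.
move=> /subsetP sBA [rr ra rt]; split=> [x /sBA/rr//|x y /sBA Ax /sBA|]; first exact: ra.
by move=> y x z /sBA Ay /sBA Ax /sBA; apply: rt.
Qed.

Lemma cut_opp r A D U : cut (opp_rel r) A U D = cut r A D U.
Proof.
apply/cutP/cutP=> -[sA dDU dD uU rDU].
  by split=> //; [rewrite setUC|rewrite disjoint_sym|move=> d u Dd Uu; apply: rDU].
by split=> //; [rewrite setUC|rewrite disjoint_sym|move=> d u Dd Uu; apply: rDU].
Qed.

End Cuts.

Lemma cut_point (T : finType) (r : rel T) (A : {set T}) x :
  order_on r A -> x \in A -> cut r (A :\ x) (below r A x) (above r A x).
Proof.
case=> rr ra rt Ax; apply/cutP; split.
- by apply/subsetP=> a; rewrite !inE => /orP[]/and3P[-> ->].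
- apply/pred0P=> a /=; rewrite !inE; apply/negP=> /andP[/and3P[Aa ax rax] /and3P[_ _ rxa]].
  by case/eqP: ax; apply: ra; rewrite ?rax.
- move=> d a; rewrite !inE => /and3P[Ad dx rdx] /andP[ax Aa] rad.
  by rewrite Aa ax (rt d a x).
- move=> d a; rewrite !inE => /and3P[Ad dx rdx] /andP[ax Aa] rad.
  by rewrite Aa ax (rt d x a).
- by move=> d u; rewrite !inE => /and3P[Ad dx rdx] /and3P[Au ux rxu]; apply: (rt x).
Qed.

(** * One-point valuations *)

Section Valuations.
Variable k : fieldType.

(** What a measure retains when only one-point extensions are kept.  Posets are
    subsets [A] of a fixed finite type with a relation [r] that orders [A], so that
    points can be removed and the new point moved without changing types.  In
    [val_insert] the four terms are the positions of the new point relative to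
    [z]: equal, incomparable, above, below; impossible positions contribute [0]
    thanks to [val_notcut].  The rules are invariant under reversing all orders. *)
Record valuation : Type := Valuation {
  val_fun :> forall T : finType, rel T -> {set T} -> {set T} -> {set T} -> k;
  corner : nat -> nat -> k;
  val_notcut : forall (T : finType) (r : rel T) A D U,
    ~~ cut r A D U -> val_fun r A D U = 0;
  val_insert : forall (T : finType) (r : rel T) A D U z,
    order_on r A -> z \in A -> cut r (A :\ z) D U ->
    val_fun r (A :\ z) D U =
      ((D == below r A z) && (U == above r A z))%:R + val_fun r A D U
      + val_fun r A (z |: D) U + val_fun r A D (z |: U);
  val_exchange : forall (T : finType) (r : rel T) A x y,
    order_on r A -> x \in A -> y \in A -> x != y ->
    val_fun r (A :\ x) (below r A x) (above r A x)
    * val_fun r (A :\ x :\ y) (below r (A :\ x) y) (above r (A :\ x) y)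
    = val_fun r (A :\ y) (below r A y) (above r A y)
      * val_fun r (A :\ y :\ x) (below r (A :\ y) x) (above r (A :\ y) x);
  val_antichains : forall (T : finType) (r : rel T) D U,
    order_on r (D :|: U) -> cut r (D :|: U) D U ->
    antichain r D -> antichain r U ->
    val_fun r (D :|: U) D U = corner #|D| #|U|
}.

Section Dual.
Variable V : valuation.

Definition dual_fun (T : finType) (r : rel T) A D U := V T (opp_rel r) A U D.

Fact dual_notcut (T : finType) (r : rel T) A D U :
  ~~ cut r A D U -> dual_fun r A D U = 0.
Proof. by move=> nc; rewrite /dual_fun val_notcut // cut_opp. Qed.

Fact dual_insert (T : finType) (r : rel T) A D U z :
  order_on r A -> z \in A -> cut r (A :\ z) D U ->
  dual_fun r (A :\ z) D U =
    ((D == below r A z) && (U == above r A z))%:R + dual_fun r A D U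
    + dual_fun r A (z |: D) U + dual_fun r A D (z |: U).
Proof.
move=> oA zA c; rewrite /dual_fun (val_insert V (order_on_opp oA) zA); last by rewrite cut_opp.
by rewrite andbC addrAC.
Qed.

Fact dual_exchange (T : finType) (r : rel T) A x y :
  order_on r A -> x \in A -> y \in A -> x != y ->
  dual_fun r (A :\ x) (below r A x) (above r A x)
  * dual_fun r (A :\ x :\ y) (below r (A :\ x) y) (above r (A :\ x) y)
  = dual_fun r (A :\ y) (below r A y) (above r A y)
    * dual_fun r (A :\ y :\ x) (below r (A :\ y) x) (above r (A :\ y) x).
Proof. by move=> oA; apply: (val_exchange V (order_on_opp oA)). Qed.

Fact dual_antichains (T : finType) (r : rel T) D U :
  order_on r (D :|: U) -> cut r (D :|: U) D U ->
  antichain r D -> antichain r U ->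
  dual_fun r (D :|: U) D U = corner V #|U| #|D|.
Proof.
rewrite setUC /dual_fun => oA c aD aU.
rewrite (val_antichains V (order_on_opp oA)) //; first by rewrite cut_opp.
  by move=> x y Ux Uy /(aU _ _ Uy Ux).
by move=> x y Dx Dy /(aD _ _ Dy Dx).
Qed.

(** Reversing all orders exchanges the two arguments of [corner], so every
    statement proved for lower sets is available for upper sets. *)
Definition dual : valuation :=
  @Valuation dual_fun (fun p q => corner V q p)
    dual_notcut dual_insert dual_exchange dual_antichains.

End Dual.

End Valuations.

(** * From measures to valuations *)

Lemma order_on_le (Q : poset) (A : {set Q}) : order_on <=%O A.
Proof.
by split=> [y _|y t _ _|y t u _ _ _]; [apply: lexx|apply: le_anti|apply: le_trans].
Qed.

Definition is_order (T : finType) (r : rel T) :=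
  [&& [forall x, r x x], [forall x, forall y, r x y && r y x ==> (x == y)]
    & [forall x, forall y, forall z, r y x && r x z ==> r y z]].

Lemma is_orderP (T : finType) (r : rel T) :
  reflect [/\ reflexive r, antisymmetric r & transitive r] (is_order r).
Proof.
apply: (iffP and3P) => -[rr ra rt]; split.
- by move=> x; move/forallP: rr.
- by move=> x y rxy; apply/eqP; move: rxy; apply/implyP; move/forallP/(_ x)/forallP/(_ y): ra.
- move=> x y z ryx rxz; move/forallP/(_ x)/forallP/(_ y)/forallP/(_ z)/implyP: rt.
  by apply; rewrite ryx.
- by apply/forallP.
- by apply/forallP=> x; apply/forallP=> y; apply/implyP=> /ra->.
- by apply/forallP=> x; apply/forallP=> y; apply/forallP=> z; apply/implyP=> /andP[]; apply: rt.
Qed.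

Section RelPoset.
Variables (T : finType) (r : rel T) (h : is_order r).

(** The proof [h] is a phantom argument: it lets the order instance be inferred
    from the type. *)
Definition rel_poset : Type := let _ := h in T.

HB.instance Definition _ := Finite.on rel_poset.

Fact rel_poset_refl : reflexive (r : rel rel_poset).
Proof. by case/is_orderP: h. Qed.
Fact rel_poset_anti : antisymmetric (r : rel rel_poset).
Proof. by case/is_orderP: h. Qed.
Fact rel_poset_trans : transitive (r : rel rel_poset).
Proof. by case/is_orderP: h. Qed.

HB.instance Definition _ := Order.Le_isPOrder.Build poset_display rel_poset
  rel_poset_refl rel_poset_anti rel_poset_trans.

Lemma rel_posetE (x y : rel_poset) : (x <= y)%O = r x y.
Proof. by []. Qed.
End RelPoset.

Section Amalgam.

(** Two posets covered by the same set are isomorphic as soon as the covers induce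
    the same preorder: antisymmetry then forces the same fibres. *)
Lemma iso_of_covers (S : finType) (B C : poset) (g : S -> B) (h : S -> C) :
    (forall z, exists s, g s = z) -> (forall z, exists s, h s = z) ->
    (forall s t, (g s <= g t)%O = (h s <= h t)%O) ->
  exists f : embedding B C, bijective f /\ forall s, f (g s) = h s.
Proof.
move=> gS hS gh.
have pickg z : exists s, g s == z by have [s <-] := gS z; exists s.
have eqgh s t : (g s == g t) = (h s == h t) by rewrite !eq_le !gh.
pose f := [ffun z => h (xchoose (pickg z))].
have fg s : f (g s) = h s.
  by rewrite ffunE; apply/eqP; rewrite -eqgh; exact: (xchooseP (pickg (g s))).
have fE : is_embedding f.
  apply/is_embeddingP; split=> z t; have [s <-] := gS z; have [u <-] := gS t; rewrite !fg //.
  by move/eqP; rewrite -eqgh => /eqP.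
exists (Embedding fE); split=> //=.
have pickh z : exists s, h s == z by have [s <-] := hS z; exists s.
exists (fun c => g (xchoose (pickh c))) => [z|c] /=.
  by have [s <-] := gS z; rewrite fg; apply/eqP; rewrite eqgh; apply: (xchooseP (pickh _)).
by rewrite fg; apply/eqP/(xchooseP (pickh c)).
Qed.

Variables (P Q P' : poset) (a : embedding P Q) (b : embedding P P') (x : Q) (z : P').
Hypothesis ax : forall y, y \in codom a \/ y = x.
Hypothesis bz : forall y, y \in codom b \/ y = z.

(** When [Q] and [P'] extend [P] by one point each, the only freedom in an
    amalgamation is the relation between the two new points.  The pair
    [(true, true)] means that they coincide. *)
Definition kind (B : amalgamation a b) : bool * bool :=
  ((am_b B x <= am_a B z)%O, (am_a B z <= am_b B x)%O).

Definition cover (B : amalgamation a b) (s : P' + Q) : B :=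
  match s with inl y => am_a B y | inr y => am_b B y end.

Lemma cover_surj (B : amalgamation a b) t : exists s, cover B s = t.
Proof.
case: (am_cover t) => /codomP[y ->]; first by exists (inl y).
by exists (inr y).
Qed.

(** The disjoint union of [P'] and [Q] covers any amalgamation, and all
    comparisons except those of the two new points are imposed by [P'] and [Q]. *)
Lemma kind_iso (B C : amalgamation a b) : kind B = kind C -> amalgamation_iso B C.
Proof.
case=> kxz kzx.
have [|f [bf fg]] := iso_of_covers (cover_surj (B := B)) (cover_surj (B := C)).
  have mixed y t : (am_a B y <= am_b B t)%O = (am_a C y <= am_b C t)%O /\
                   (am_b B t <= am_a B y)%O = (am_b C t <= am_a C y)%O.
    case: (ax t) => [/codomP[s ->]|->]; first by rewrite !am_comm -!emb_le.
    case: (bz y) => [/codomP[s ->]|->]; first by rewrite -!am_comm -!emb_le.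
    by rewrite kxz kzx.
  move=> [s|s] [t|t] /=; rewrite -?emb_le //; first by case: (mixed s t).
  by case: (mixed t s).
exists f; split=> // y; first exact: (fg (inl y)).
exact: (fg (inr y)).
Qed.

Lemma iso_kind (B C : amalgamation a b) : amalgamation_iso B C -> kind B = kind C.
Proof. by case=> f [_ fa fb]; rewrite /kind -fa -fb -!emb_le. Qed.

Variables (k : fieldType) (nu : measure k).
Variable C : bool * bool -> option (amalgamation a b).
Hypothesis kindC : forall e B, C e = Some B -> kind B = e.
Hypothesis C_None : forall e B, C e = None -> kind B <> e.

(** The amalgamation axiom of a measure, with the isomorphism classes indexed by
    their kinds.  The function [C] selects an amalgamation of each kind that occurs. *)
Lemma amalgamation_sum :
  nu P Q a = \sum_e oapp (fun B : amalgamation a b => nu P' B (am_a B)) 0 (C e).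
Proof.
pose K := [set e | isSome (C e)].
have someC (i : 'I_#|K|) : isSome (C (enum_val i)).
  by have := enum_valP i; rewrite inE.
pose get e : isSome (C e) -> amalgamation a b :=
  match C e as o return isSome o -> amalgamation a b with
  | Some B => fun _ => B
  | None => fun no => False_rect _ (notF no)
  end.
have getE e (s : isSome (C e)) : C e = Some (get e s).
  by move: s; rewrite /get; case: (C e).
rewrite (measure_amalg nu (A := fun i => get _ (someC i))).
  rewrite [RHS](bigID (mem K)) /= [X in _ + X]big1 ?addr0; last first.
    by move=> e; rewrite inE; case: (C e).
  rewrite [RHS]big_enum_val; apply: eq_bigr => i _.
  by rewrite (getE _ (someC i)).
split=> [i j /iso_kind|B].
  by rewrite (kindC (getE _ (someC i))) (kindC (getE _ (someC j))) => /enum_val_inj.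
have KB : kind B \in K by rewrite inE; case CB: (C _) => //; case: (C_None CB (erefl (kind B))).
exists (enum_rank_in KB (kind B)); apply: kind_iso.
by rewrite (kindC (getE _ (someC _))) enum_rankK_in.
Qed.

End Amalgam.

(** The source of a one-point extension is isomorphic to its target with the
    point removed. *)
Lemma measure_one_point (k : fieldType) (nu : measure k) (P Q : poset)
    (a : embedding P Q) (x : Q) :
  (forall y, (y \in codom a) = (y != x)) -> nu P Q a = measure_marked x nu.
Proof.
move=> ax.
have nx p : a p != x by rewrite -ax codom_f.
pose g := [ffun p => Sub (a p) (nx p) : point_del x].
have gE : is_embedding g.
  apply/is_embeddingP; split=> p p'; rewrite !ffunE.
    by move/(congr1 val) => /= /emb_inj.
  by rewrite leEsub /= -emb_le.
have -> : a = emb_comp (point_del_emb x) (Embedding gE).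
  by apply/val_inj/ffunP=> p; rewrite /= !ffunE.
rewrite measure_comp (measure_iso nu (a := Embedding gE)) ?mulr1 //.
have ga (y : point_del x) : exists p, g p == y.
  have : val y \in codom a by rewrite ax (valP y).
  by case/codomP=> p yp; exists p; rewrite ffunE -val_eqE /= -yp.
exists (fun y => xchoose (ga y)) => [p|y] /=; last by apply/eqP/(xchooseP (ga y)).
by apply: (emb_inj (f := Embedding gE)); apply/eqP/(xchooseP (ga _)).
Qed.

Lemma measure_marked_iso (k : fieldType) (nu : measure k) (P Q : poset) (f : P -> Q) x :
    bijective f -> (forall a b, (a <= b)%O = (f a <= f b)%O) ->
  measure_marked x nu = measure_marked (f x) nu.
Proof.
move=> bf fM; have fE : is_embedding (finfun f).
  by apply/is_embeddingP; split=> a b; rewrite !ffunE //; apply: bij_inj.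
have bF : bijective (Embedding fE).
  by apply: (eq_bij bf) => a; rewrite /= ffunE.
rewrite -(measure_one_point nu (a := emb_comp (Embedding fE) (point_del_emb x))).
  by rewrite measure_comp (measure_iso nu bF) mul1r.
move=> y; apply/codomP/idP => [[p ->]|yx].
  by rewrite /= !ffunE (inj_eq (bij_inj bf)) (valP p).
case: bf => g fK gK; have gy : g y != x by apply: contraNneq yx => <-; rewrite gK.
by exists (Sub (g y) gy : point_del x); rewrite /= !ffunE gK.
Qed.

Section FromMeasure.
Variables (k : fieldType) (nu : measure k).

Section OneType.
Variables (T : finType) (r : rel T).
Implicit Types (A D U : {set T}).

Definition ext_rel A D U : rel (option {z | z \in A}) := fun s t =>
  match s, t with
  | Some a, Some b => r (val a) (val b)
  | Some a, None => val a \in D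
  | None, Some b => val b \in U
  | None, None => true
  end.

Definition sub_rel A : rel {z | z \in A} := relpre val r.
Arguments sub_rel A : clear implicits.
Arguments ext_rel A D U : clear implicits.

Lemma is_order_sub A : order_on r A -> is_order (sub_rel A).
Proof.
case=> rr ra rt; apply/is_orderP; split=> [x|x y|y x z] /=; first exact/rr/valP.
  by move=> rxy; apply/val_inj/ra => //; apply: valP.
by apply: rt; apply: valP.
Qed.

Lemma is_order_ext A D U : order_on r A -> cut r A D U -> is_order (ext_rel A D U).
Proof.
move=> [rr ra rt] /cutP[sA dDU dD uU rDU]; apply/is_orderP; split.
- by move=> [s|] //=; apply/rr/valP.
- move=> [s|] [t|] //=; first by move=> rst; congr Some; apply/val_inj/ra => //; apply: valP.
    by rewrite andbC => /andP[Us Ds]; rewrite (disjointFr dDU) in Us.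
  by case/andP=> Us Ds; rewrite (disjointFr dDU) in Us.
- move=> [y|] [x|] [z|] //=; first by apply: rt; apply: valP.
  + by move=> rxy Dy; apply: dD rxy => //; apply: valP.
  + by move=> Uy ryz; apply: uU ryz => //; apply: valP.
  + by move=> Dy Uz; apply: rDU.
Qed.

Definition extension A D U (h : is_order (ext_rel A D U)) : poset := rel_poset h.
Definition subposet A (h : is_order (sub_rel A)) : poset := rel_poset h.

(** The fallback value [0] of the inner test is never reached when [r] orders
    [A], by [is_order_ext]. *)
Definition point_value A D U : k :=
  if cut r A D U then
    if decP (@idP (is_order (ext_rel A D U))) is left h
    then measure_marked (None : extension h) nu else 0
  else 0.

Lemma point_value_notcut A D U : ~~ cut r A D U -> point_value A D U = 0.
Proof. by move=> /negPf c; rewrite /point_value c. Qed.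

Lemma point_valueE A D U (Q : poset) (x : Q) (g : Q -> option {z | z \in A}) :
    cut r A D U -> bijective g -> g x = None ->
    (forall s t, (s <= t)%O = ext_rel A D U (g s) (g t)) ->
  point_value A D U = measure_marked x nu.
Proof.
move=> c bg gx gM; rewrite /point_value c; case: decP => [h|]; last first.
  case: bg => f fK gK; case; apply/is_orderP; split=> [s|s t|s t u].
  - by rewrite -(gK s) -gM.
  - by rewrite -(gK s) -(gK t) -!gM => /le_anti->.
  - by rewrite -(gK s) -(gK t) -(gK u) -!gM; apply: le_trans.
by rewrite (@measure_marked_iso k nu Q (extension h) g x bg gM) gx.
Qed.

(** Deleting [x] and adding a point in its place: [None] stands for [x]. *)
Lemma insub_bij A (x : T) : x \in A ->
  bijective (fun t : {z | z \in A} => insub (val t) : option {z | z \in A :\ x}).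
Proof.
move=> Ax; apply: inj_card_bij; last first.
  by rewrite card_option !card_sig (cardsD1 x A) Ax.
move=> s t; case: insubP => [s' _ es|]; case: insubP => [t' _ et|] //.
  by case=> st; apply: val_inj; rewrite -es -et st.
by rewrite !inE !negb_and !negbK !(valP s) !(valP t) !orbF => /eqP ts /eqP ss _;
  apply: val_inj; rewrite ts ss.
Qed.

Lemma sub_point_value A x (h : is_order (sub_rel A)) (Ax : x \in A) :
    order_on r A ->
  point_value (A :\ x) (below r A x) (above r A x)
  = measure_marked (Sub x Ax : subposet h) nu.
Proof.
move=> o; apply: (point_valueE (g := fun t : subposet h => insub (val t))).
- exact: cut_point.
- exact: insub_bij.
- by apply: insubF; rewrite !inE /= eqxx.
move=> s t; rewrite rel_posetE /sub_rel /=.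
have As : val s \in A := valP s; have At : val t \in A := valP t.
case: insubP => [s' _ es|]; case: insubP => [t' _ et|] /=; rewrite ?es ?et //.
- by rewrite !inE At andbT negbK => /eqP->; rewrite -es; move: (valP s'); rewrite !inE => /andP[-> ->].
- by rewrite !inE As andbT negbK => /eqP->; rewrite -et; move: (valP t'); rewrite !inE => /andP[-> ->].
rewrite !inE As At !andbT !negbK => /eqP-> /eqP->.
by case: o => rr _ _; rewrite rr.
Qed.

Section Inclusion.
Variables (A B : {set T}) (hA : is_order (sub_rel A)) (hB : is_order (sub_rel B)).
Hypothesis sBA : B \subset A.

Definition widen (s : {z | z \in B}) : {z | z \in A} :=
  Sub (val s) (subsetP sBA _ (valP s)).

Fact incl_subproof :
  is_embedding ([ffun s => widen s] : {ffun subposet hB -> subposet hA}).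
Proof.
apply/is_embeddingP; split=> s t; rewrite !ffunE //.
by move/(congr1 val) => /= /val_inj.
Qed.

Definition incl : embedding (subposet hB) (subposet hA) := Embedding incl_subproof.
End Inclusion.

Lemma incl_point_value A x (hA : is_order (sub_rel A)) (hB : is_order (sub_rel (A :\ x)))
    (s : A :\ x \subset A) : order_on r A -> x \in A ->
  nu _ _ (incl hA hB s) = point_value (A :\ x) (below r A x) (above r A x).
Proof.
move=> o Ax; rewrite (sub_point_value hA Ax o); apply: measure_one_point => y.
apply/codomP/idP => [[t ->]|yx].
  by rewrite ffunE -val_eqE /=; have := valP t; rewrite !inE => /andP[].
have By : val y \in A :\ x by rewrite !inE (valP y : val y \in A) andbT.
by exists (Sub (val y) By); rewrite ffunE; apply: val_inj.
Qed.

(** Both sides are the measure of the inclusion of [A :\ x :\ y] into [A]. *)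
Lemma point_value_exchange A x y :
    order_on r A -> x \in A -> y \in A -> x != y ->
  point_value (A :\ x) (below r A x) (above r A x)
  * point_value (A :\ x :\ y) (below r (A :\ x) y) (above r (A :\ x) y)
  = point_value (A :\ y) (below r A y) (above r A y)
    * point_value (A :\ y :\ x) (below r (A :\ y) x) (above r (A :\ y) x).
Proof.
move=> o Ax Ay xy.
have oD B z : order_on r B -> order_on r (B :\ z) by apply: order_onS; apply: subsetDl.
have hA := is_order_sub o.
have path z z' : z \in A -> z' \in A :\ z ->
    forall C (hC : is_order (sub_rel C)) (sC : C \subset A), C = A :\ z :\ z' ->
  point_value (A :\ z) (below r A z) (above r A z)
  * point_value (A :\ z :\ z') (below r (A :\ z) z') (above r (A :\ z) z')
  = nu _ _ (incl hA hC sC).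
  move=> Az Az' C hC sC eC; move: hC sC; rewrite eC => hC sC.
  have hz := is_order_sub (oD A z o).
  rewrite -(incl_point_value hA hz (subsetDl _ _) o Az).
  rewrite -(incl_point_value hz hC (subsetDl _ _) (oD A z o) Az') -measure_comp.
  congr (nu _ _ _); apply/val_inj/ffunP=> t; rewrite /= !ffunE.
  by apply: val_inj.
have hC := is_order_sub (oD _ y (oD A x o)).
have sC : A :\ x :\ y \subset A.
  by apply: subset_trans (subsetDl _ _); apply: subsetDl.
rewrite (path x y Ax _ _ hC sC) // ?inE 1?eq_sym ?xy //.
rewrite (path y x Ay _ _ hC sC) // ?inE ?xy //.
by apply/setP=> z; rewrite !inE andbCA.
Qed.

(** Enumerating [D] and [U] identifies the extension with [Jposet #|D| #|U|]. *)
Lemma point_value_antichains D U :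
    order_on r (D :|: U) -> cut r (D :|: U) D U -> antichain r D -> antichain r U ->
  point_value (D :|: U) D U = nuJ nu #|D| #|U|.
Proof.
move=> o c aD aU.
have inD (i : 'I_#|D|) : enum_val i \in D :|: U by rewrite inE enum_valP.
have inU (i : 'I_#|U|) : enum_val i \in D :|: U by rewrite inE enum_valP orbT.
pose g (t : Jposet #|D| #|U|) : option {z | z \in D :|: U} :=
  match t with
  | Some (inl i) => Some (Sub (enum_val i) (inD i))
  | Some (inr i) => Some (Sub (enum_val i) (inU i))
  | None => None
  end.
case/cutP: (c) => _ dDU dD uU rDU; case: (o) => rr ra _.
have nUD (i : 'I_#|D|) (j : 'I_#|U|) : enum_val i != enum_val j.
  by apply: contraTneq (enum_valP i) => ->; rewrite (disjointFl dDU) // enum_valP.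
apply: (point_valueE (g := g)) => //.
  apply: inj_card_bij; last first.
    by rewrite card_option card_sig card_option card_sum !card_ord cardsU disjoint_setI0 // cards0 subn0.
  move=> [[i|i]|] [[j|j]|] //= [].
  - by move/enum_val_inj->.
  - by move/eqP; rewrite (negPf (nUD i j)).
  - by move/esym/eqP; rewrite (negPf (nUD j i)).
  - by move/enum_val_inj->.
move=> s t; rewrite [LHS]JleE.
case: s t => [[i|i]|] [[j|j]|] //=; rewrite ?ltnn ?orbF ?eqxx ?enum_valP //.
- apply/eqP/idP => [[->]|/aD]; first by rewrite rr ?inD.
  by move=> e; rewrite (enum_val_inj (e _ _)) // enum_valP.
- by rewrite rDU ?enum_valP.
- apply/esym/negP=> rij; have := dD (enum_val j) (enum_val i); rewrite enum_valP inU rij.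
  by rewrite (disjointFl dDU) ?enum_valP // => /(_ isT isT isT).
- apply/eqP/idP => [[->]|/aU]; first by rewrite rr ?inU.
  by move=> e; rewrite (enum_val_inj (e _ _)) // enum_valP.
- by rewrite (disjointFl dDU) // enum_valP.
- by rewrite (disjointFr dDU) // enum_valP.
Qed.

(** The insertion rule is the amalgamation axiom for the extension [Q] of
    [P = A :\ z] by the cut [(D, U)] and for [P' = A]. *)
Section Insertion.
Variables (A D U : {set T}) (z : T).
Hypotheses (oA : order_on r A) (Az : z \in A) (cB : cut r (A :\ z) D U).

Let B := A :\ z.
Let hA : is_order (sub_rel A) := is_order_sub oA.
Let oB : order_on r B := order_onS (subsetDl _ _) oA.
Let hB : is_order (sub_rel B) := is_order_sub oB.
Let hQ : is_order (ext_rel B D U) := is_order_ext oB cB.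
Let P := subposet hB.
Let P' := subposet hA.
Let Q := extension hQ.
Let sBA : B \subset A := subsetDl _ _.
Let b : embedding P P' := incl hA hB sBA.
Let zA : P' := Sub z Az.
Let xQ : Q := None.

Fact some_subproof C E F (h : is_order (ext_rel C E F)) (hC : is_order (sub_rel C)) :
  is_embedding ([ffun s => Some s] : {ffun subposet hC -> extension h}).
Proof. by apply/is_embeddingP; split=> s t; rewrite !ffunE //; case. Qed.

Definition some_emb C E F (h : is_order (ext_rel C E F)) (hC : is_order (sub_rel C)) :
  embedding (subposet hC) (extension h) := Embedding (some_subproof h hC).

Lemma some_emb_value C E F (h : is_order (ext_rel C E F)) (hC : is_order (sub_rel C)) :
  cut r C E F -> nu _ _ (some_emb h hC) = point_value C E F.
Proof.
move=> c; rewrite (point_valueE (Q := extension h) (x := None) (g := id)) //; last by exists id.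
apply: measure_one_point => y; apply/codomP/idP => [[s ->]|]; first by rewrite ffunE.
by case: y => // s _; exists s; rewrite ffunE.
Qed.

Let a : embedding P Q := some_emb hQ hB.

Let ax (y : Q) : y \in codom a \/ y = xQ.
Proof.
by case: y => [s|]; [left; apply/codomP; exists s; rewrite ffunE|right].
Qed.

Let bz (y : P') : y \in codom b \/ y = zA.
Proof.
have [yz|yz] := eqVneq (val y) z; first by right; apply: val_inj.
have By : val y \in B by rewrite !inE yz (valP y : val y \in A).
by left; apply/codomP; exists (Sub (val y) By); rewrite ffunE; apply: val_inj.
Qed.

(** The amalgamations in which the new point of [Q] differs from [z] are the
    extensions of [A] by a cut that restricts to [(D, U)]. *)
Section FreePoint.
Variables (D' U' : {set T}).
Hypotheses (eD : D' :\ z = D) (eU : U' :\ z = U) (c : cut r A D' U').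
Let h := is_order_ext oA c.

Let inD s : s \in B -> (s \in D) = (s \in D').
Proof. by rewrite -eD !inE => /andP[->]. Qed.
Let inU s : s \in B -> (s \in U) = (s \in U').
Proof. by rewrite -eU !inE => /andP[->]. Qed.

Fact lift_subproof :
  is_embedding ([ffun s => omap (widen sBA) s] : {ffun Q -> extension h}).
Proof.
apply/is_embeddingP; split=> [[s|] [t|]|[s|] [t|]]; rewrite !ffunE //=.
- by case=> /val_inj->.
- by rewrite !rel_posetE /= inD ?(valP s).
- by rewrite !rel_posetE /= inU ?(valP t).
Qed.

Fact free_comm (s : P) : Embedding lift_subproof (a s) = some_emb h hA (b s).
Proof. by rewrite /= !ffunE. Qed.

Fact free_cover (t : extension h) :
  t \in codom (some_emb h hA) \/ t \in codom (Embedding lift_subproof).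
Proof.
case: t => [s|]; [left|right]; apply/codomP; first by exists s; rewrite ffunE.
by exists None; rewrite ffunE.
Qed.

Definition free_amalgam : amalgamation a b :=
  Amalgamation free_comm free_cover.

Lemma kind_free : kind xQ zA free_amalgam = (z \in U', z \in D').
Proof. by rewrite /kind /= !ffunE. Qed.
End FreePoint.

(** If [z] has the type of the new point, [A] itself is an amalgamation. *)
Section SamePoint.
Hypotheses (eD : D = below r A z) (eU : U = above r A z).

Fact fuse_subproof :
  is_embedding ([ffun s => if s is Some s' then widen sBA s' else zA] : {ffun Q -> P'}).
Proof.
have rz : r z z by case: oA => rr _ _; apply: rr.
have Bz (s : {z | z \in B}) : val s != z by have := valP s; rewrite !inE => /andP[].
have BA (s : {z | z \in B}) : val s \in A by have := valP s; rewrite !inE => /andP[].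
apply/is_embeddingP; split=> [[s|] [t|]|[s|] [t|]]; rewrite !ffunE //=.
- by move/(congr1 val) => /= /val_inj->.
- by move/(congr1 val) => /= /eqP; rewrite (negPf (Bz s)).
- by move/(congr1 val) => /= /esym/eqP; rewrite (negPf (Bz t)).
- by rewrite !rel_posetE /= /sub_rel /= eD inE BA Bz.
- by rewrite !rel_posetE /= /sub_rel /= eU inE BA Bz.
Qed.

Fact id_subproof : is_embedding ([ffun s => s] : {ffun P' -> P'}).
Proof. by apply/is_embeddingP; split=> s t; rewrite !ffunE. Qed.

Fact same_comm (s : P) : Embedding fuse_subproof (a s) = Embedding id_subproof (b s).
Proof. by rewrite /= !ffunE. Qed.

Fact same_cover (t : P') :
  t \in codom (Embedding id_subproof) \/ t \in codom (Embedding fuse_subproof).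
Proof. by left; apply/codomP; exists t; rewrite ffunE. Qed.

Definition same_amalgam : amalgamation a b := Amalgamation same_comm same_cover.

Lemma kind_same : kind xQ zA same_amalgam = (true, true).
Proof. by rewrite /kind /= !ffunE lexx. Qed.

Lemma same_value : nu _ _ (am_a same_amalgam) = 1.
Proof. by apply: measure_iso; exists id => s; rewrite ffunE. Qed.
End SamePoint.

(** If the two new points coincide in [X], then comparing them with a point of
    [P] shows that they have the same type. *)
Lemma amalgam_same (X : amalgamation a b) : kind xQ zA X = (true, true) ->
  D = below r A z /\ U = above r A z.
Proof.
case=> le1 le2; have eX : am_b X None = am_a X zA by apply/le_anti/andP.
have D_A s (Bs : s \in B) : ((s \in D) = r s z) * ((s \in U) = r z s).
  have Eab : am_b X (Some (Sub s Bs)) = am_a X (widen sBA (Sub s Bs)).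
    by have := am_comm X (Sub s Bs); rewrite !ffunE.
  have := emb_le (am_b X) (Some (Sub s Bs)) None.
  have := emb_le (am_b X) None (Some (Sub s Bs)).
  by rewrite Eab eX -!emb_le.
have /subsetP sDU : D :|: U \subset B by case/and5P: cB.
split; apply/setP=> s; have [Bs|B's] := boolP (s \in B).
- by rewrite D_A // inE; move: Bs; rewrite !inE => /andP[-> ->].
- have /negPf-> : s \notin D by apply: contra B's => Ds; rewrite sDU // inE Ds.
  by move: B's; rewrite !inE; case: (s \in A); case: (s != z).
- by rewrite D_A // inE; move: Bs; rewrite !inE => /andP[-> ->].
have /negPf-> : s \notin U by apply: contra B's => Us; rewrite sDU // inE Us orbT.
by move: B's; rewrite !inE; case: (s \in A); case: (s != z).
Qed.

(** For [e <> (true, true)], [e.1] says that the new point is below [z] and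
    [e.2] that it is above. *)
Let insertion_cut (e : bool * bool) :=
  cut r A (if e.2 then z |: D else D) (if e.1 then z |: U else U).

(** Any amalgamation with two distinct new points yields a cut of [A], namely the
    points below and above the new point of [Q]. *)
Lemma amalgam_cut (X : amalgamation a b) e :
  kind xQ zA X = e -> e <> (true, true) -> insertion_cut e.
Proof.
move=> kX ne; have /subsetP sDU : D :|: U \subset B by case/and5P: cB.
rewrite /insertion_cut; set D' := if e.2 then _ else _; set U' := if e.1 then _ else _.
have z'DU : (z \in D = false) * (z \in U = false).
  by split; apply/negP=> zDU; have := sDU z; rewrite !inE zDU ?orbT eqxx => /(_ isT).
have inDU (s : P') : ((val s \in D') = (am_a X s <= am_b X xQ)%O)
                   * ((val s \in U') = (am_b X xQ <= am_a X s)%O).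
  case: (bz s) => [/codomP[s' ->]|->]; last first.
    rewrite /= /D' /U' -kX /kind /=.
    by split; [case: (am_a X zA <= _)%O|case: (_ <= am_a X zA)%O]; rewrite ?inE ?eqxx ?z'DU.
  rewrite -!am_comm -!emb_le /= !ffunE !rel_posetE /=.
  have : val s' != z by have := valP s'; rewrite !inE => /andP[].
  by rewrite /D' /U' => /negPf s'z; split; [case: e.2|case: e.1]; rewrite ?inE ?s'z.
have sDA : D' \subset A.
  have sD : D \subset A by apply/subsetP=> s Ds; have := sDU s; rewrite !inE Ds => /(_ isT)/andP[].
  by rewrite /D'; case: e.2; rewrite // subUset sub1set Az.
have sUA : U' \subset A.
  have sU : U \subset A by apply/subsetP=> s Us; have := sDU s; rewrite !inE Us orbT => /(_ isT)/andP[].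
  by rewrite /U'; case: e.1; rewrite // subUset sub1set Az.
have inD s (As : s \in A) : (s \in D') = (am_a X (Sub s As : P') <= am_b X xQ)%O.
  by rewrite -inDU.
have inU s (As : s \in A) : (s \in U') = (am_b X xQ <= am_a X (Sub s As : P'))%O.
  by rewrite -inDU.
have le_a s t (As : s \in A) (At : t \in A) :
    r s t = (am_a X (Sub s As : P') <= am_a X (Sub t At : P'))%O by rewrite -emb_le.
apply/cutP; split; first by rewrite subUset sDA.
- apply/pred0P=> s /=; apply/negP=> /andP[Ds Us]; have As := subsetP sDA s Ds.
  move: Ds Us; rewrite (inD s As) (inU s As).
  case: (bz (Sub s As)) => [/codomP[s' ->]|->] le1 le2; last by case: ne; rewrite -kX /kind le1 le2.
  move: le1 le2; rewrite -!am_comm -!emb_le => le1 le2.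
  by have /le_anti := introT andP (conj le1 le2); rewrite ffunE.
- move=> d s Dd As; have Ad := subsetP sDA d Dd.
  by move: Dd; rewrite (inD d Ad) (inD s As) (le_a s d As Ad) => + le; apply: le_trans.
- move=> u s Uu As; have Au := subsetP sUA u Uu.
  by move: Uu; rewrite (inU u Au) (inU s As) (le_a u s Au As); apply: le_trans.
- move=> d u Dd Uu; have Ad := subsetP sDA d Dd; have Au := subsetP sUA u Uu.
  by move: Dd Uu; rewrite (inD d Ad) (inU u Au) (le_a d u Ad Au); apply: le_trans.
Qed.

Let zD : (z \in D) = false.
Proof.
apply/negP=> zD; have /subsetP/(_ z) : D :|: U \subset B by case/and5P: cB.
by rewrite !inE zD eqxx => /(_ isT).
Qed.

Let zU : (z \in U) = false.
Proof.
apply/negP=> zU; have /subsetP/(_ z) : D :|: U \subset B by case/and5P: cB.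
by rewrite !inE zU eqxx orbT => /(_ isT).
Qed.

Let D'D (e : bool * bool) : (if e.2 then z |: D else D) :\ z = D.
Proof.
case: e.2; first by rewrite setU1K ?zD.
by apply/setDidPl; rewrite disjoint_sym disjoints1 zD.
Qed.

Let U'U (e : bool * bool) : (if e.1 then z |: U else U) :\ z = U.
Proof.
case: e.1; first by rewrite setU1K ?zU.
by apply/setDidPl; rewrite disjoint_sym disjoints1 zU.
Qed.

Let same := (D == below r A z) && (U == above r A z).

Let amalgam_of_kind (e : bool * bool) : option (amalgamation a b) :=
  if e == (true, true) then
    if decP (@idP same) is left eDU then
      Some (same_amalgam (eqP (proj1 (andP eDU))) (eqP (proj2 (andP eDU))))
    else None
  else if decP (@idP (insertion_cut e)) is left c then Some (free_amalgam (D'D e) (U'U e) c)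
  else None.

Lemma point_value_insert :
  point_value (A :\ z) D U =
    same%:R + point_value A D U + point_value A (z |: D) U + point_value A D (z |: U).
Proof.
rewrite -(some_emb_value hQ hB) //.
rewrite (@amalgamation_sum _ _ _ a b xQ zA ax bz k nu amalgam_of_kind).
- rewrite (_ : \sum_e _ = \sum_u \sum_d oapp (fun X : amalgamation a b => nu P' X (am_a X)) 0
     (amalgam_of_kind (u, d))); last by rewrite pair_bigA; apply: eq_bigr => -[].
  rewrite !big_bool.
  have free_value e : e != (true, true) ->
      oapp (fun X : amalgamation a b => nu P' X (am_a X)) 0 (amalgam_of_kind e)
      = point_value A (if e.2 then z |: D else D) (if e.1 then z |: U else U).
    move=> /negPf ne; rewrite /amalgam_of_kind ne; case: decP => [c|/negP c] /=.
      exact: some_emb_value.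
    by rewrite point_value_notcut.
  rewrite (free_value (true, false)) // (free_value (false, true)) //.
  rewrite (free_value (false, false)) //= /amalgam_of_kind eqxx.
  case: decP => [eDU|/negP/negPf->] /=; last by ring.
  by case/andP: (eDU) => /eqP eD /eqP eU; rewrite (same_value eD eU) eDU /=; ring.
- move=> e X; rewrite /amalgam_of_kind; case: (e =P (true, true)) => [->|ne]; case: decP => // c [<-].
    exact: kind_same.
  by rewrite kind_free; case: e ne c => -[] [] //= _ _; rewrite ?inE ?eqxx ?zD ?zU.
move=> e X; rewrite /amalgam_of_kind; case: (e =P (true, true)) => [->|ne]; case: decP => // c _.
  by move/amalgam_same=> [eD eU]; apply: c; rewrite /same eD eU !eqxx.
by move=> kX; apply: c; apply: amalgam_cut kX ne.
Qed.

End Insertion.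
End OneType.

Definition valuation_of_measure : valuation k :=
  @Valuation k point_value (nuJ nu) point_value_notcut
    (fun T r A D U z o Az c => point_value_insert o Az c)
    point_value_exchange point_value_antichains.

Lemma measure_marked_value (Q : poset) (x : Q) :
  measure_marked x nu
  = point_value (<=%O : rel Q) (setT :\ x) (below <=%O setT x) (above <=%O setT x).
Proof.
have o := order_on_le (setT : {set Q}).
have h := is_order_sub o.
rewrite (sub_point_value h (in_setT x) o).
pose f (y : Q) : subposet h := Sub y (in_setT y).
apply: (measure_marked_iso nu (f := f)) => //.
by exists val => // y; apply: val_inj.
Qed.

End FromMeasure.

(** * Reduction to corner values *)

Section Reduction.
Variable k : fieldType.

(** A point [d] strictly below another point [e] of [D] is redundant: when [d] is
    inserted, its position below the new point is forced through [e]. *)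
Lemma val_drop_lower (V : valuation k) (T : finType) (r : rel T) A D U d e :
    order_on r A -> cut r A D U -> d \in D -> e \in D -> d != e -> r d e ->
  V T r (A :\ d) (D :\ d) U = V T r A D U.
Proof.
move=> oA /cutP[sA dDU dD uU rDU] Dd De de rde.
have Ad : d \in A by apply: (subsetP sA); rewrite inE Dd.
have Ae : e \in A by apply: (subsetP sA); rewrite inE De.
have U'd : d \notin U by rewrite (disjointFr dDU).
have U'e : e \notin U by rewrite (disjointFr dDU).
rewrite (val_insert V oA Ad); last first.
  apply/cutP; split.
  - by apply/subsetP=> x; rewrite !inE => /orP[/andP[-> Dx]|Ux];
      rewrite (subsetP sA) ?inE ?Dx ?Ux ?orbT // andbT; apply: contraNneq U'd => <-.
  - by apply: disjointWl dDU; apply: subsetDl.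
  - move=> x a; rewrite !inE => /andP[_ Dx] /andP[-> Aa]; exact: dD.
  - by move=> u a Uu; rewrite !inE => /andP[_ Aa]; apply: uU.
  - by move=> x u; rewrite !inE => /andP[_ Dx]; apply: rDU.
rewrite setD1K // [X in (X && _)%:R](_ : _ = false) ?add0r; last first.
  apply/eqP=> /setP/(_ e); rewrite !inE eq_sym de De Ae /= => /esym red.
  by case: oA => _ /(_ d e Ad Ae) ra _; rewrite ra ?rde ?red ?eqxx in de.
rewrite (val_notcut V); last first.
  apply/negP=> /cutP[_ _ /(_ e d)]; rewrite !inE eq_sym de De Ad eqxx.
  by move=> /(_ isT isT rde).
rewrite add0r [V T r A (D :\ d) (d |: U)](val_notcut V) ?addr0 //.
apply/negP=> /cutP[_ _ _ /(_ d e) + _].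
by rewrite !inE eq_sym (negPf de) (negPf U'e) eqxx => /(_ isT Ae rde).
Qed.

Lemma maximaD1 (T : finType) (r : rel T) D d e :
    order_on r D -> d \in D -> e \in D -> d != e -> r d e ->
  maxima r (D :\ d) = maxima r D.
Proof.
move=> [_ ra rt] Dd De de rde; apply/setP=> x; rewrite !inE.
have [->|xd] := eqVneq x d; rewrite /=.
  by rewrite Dd /=; apply/esym/negP=> /forall_inP/(_ e De); rewrite rde eq_sym (negPf de).
case Dx: (x \in D) => //=; apply/forall_inP/forall_inP=> mx y.
  move=> Dy; apply/implyP=> rxy; have [yd|yd] := eqVneq y d; last first.
    by apply: (implyP (mx y _)); rewrite // !inE yd.
  have: r x e by apply: rt rde; rewrite ?Dd ?Dx // -yd.
  move/(implyP (mx e _)); rewrite !inE eq_sym de De => /(_ isT)/eqP ex.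
  by have := ra d e Dd De; rewrite rde ex -yd rxy => /(_ isT) ->.
by rewrite in_setD1 => /andP[_ /mx].
Qed.

Lemma maxima_antichain (T : finType) (r : rel T) D :
  maxima r D = D -> antichain r D.
Proof.
move=> mD x y Dx Dy rxy; move: Dx; rewrite -mD inE => /andP[_ /forall_inP/(_ y Dy)].
by rewrite rxy => /eqP.
Qed.

Lemma not_maximal (T : finType) (r : rel T) (D : {set T}) d :
  d \in D -> d \notin maxima r D -> exists2 e, e \in D & d != e /\ r d e.
Proof.
rewrite inE => -> /= /forall_inPn[e De]; rewrite negb_imply => /andP[rde de].
by exists e => //; rewrite eq_sym.
Qed.

Lemma cut_D1 (T : finType) (r : rel T) D U d :
  cut r (D :|: U) D U -> cut r (D :\ d :|: U) (D :\ d) U.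
Proof.
case/cutP=> [sA dDU dD uU rDU]; apply/cutP; split=> //.
- by apply: disjointWl dDU; apply: subsetDl.
- move=> x a; rewrite !inE => /andP[xd Dx] /orP[/andP[-> ->] //|Ua rax].
  by move: (dD x a Dx); rewrite !inE Ua orbT (disjointFl dDU Ua) => /(_ isT rax).
- by move=> u a Uu; rewrite !inE => Aa; apply: uU => //; rewrite inE;
    case/orP: Aa => [/andP[_ ->]|->]; rewrite ?orbT.
- by move=> x u; rewrite !inE => /andP[_ Dx]; apply: rDU.
Qed.

(** Deleting redundant points of [D] and of [U] until only the maximal points
    of [D] and the minimal points of [U] remain leads to a corner value. *)
Lemma val_full (V : valuation k) (T : finType) (r : rel T) D U :
    order_on r (D :|: U) -> cut r (D :|: U) D U ->
  V T r (D :|: U) D U = corner V #|maxima r D| #|maxima (opp_rel r) U|.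
Proof.
have [n leDU] := ubnP #|D :|: U|; elim: n => // n IHn in D U leDU *; move=> o c.
have dDU : [disjoint D & U] by case/cutP: c.
have [mD|mD] := eqVneq (maxima r D) D; last first.
  have /subsetPn[d Dd /(not_maximal Dd)[e De [de rde]]] : ~~ (D \subset maxima r D).
    by apply: contraNN mD => sD; rewrite eqEsubset sD andbT; apply/subsetP=> x; rewrite inE => /andP[].
  have eA : (D :|: U) :\ d = D :\ d :|: U.
    by apply/setP=> x; rewrite !inE; case: eqVneq => //= ->; rewrite (disjointFr dDU).
  rewrite -(val_drop_lower V o c Dd De de rde) eA IHn.
  - by rewrite (maximaD1 (order_onS _ o) Dd De de rde) ?subsetUl.
  - apply: leq_trans (_ : #|D :|: U| <= n)%N; rewrite // -eA; apply/proper_card/properD1.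
    by rewrite inE Dd.
  - by apply: order_onS o; rewrite setSU // subsetDl.
  - exact: cut_D1.
have [mU|mU] := eqVneq (maxima (opp_rel r) U) U; last first.
  have /subsetPn[d Ud /(not_maximal Ud)[e Ue [de rde]]] : ~~ (U \subset maxima (opp_rel r) U).
    by apply: contraNN mU => sU; rewrite eqEsubset sU andbT; apply/subsetP=> x; rewrite inE => /andP[].
  have eA : (D :|: U) :\ d = D :|: U :\ d.
    by apply/setP=> x; rewrite !inE; case: eqVneq => //= ->; rewrite (disjointFl dDU).
  have o' := order_on_opp o.
  have c' : cut (opp_rel r) (D :|: U) U D by rewrite cut_opp.
  have /= := val_drop_lower (dual V) o' c' Ud Ue de rde.
  rewrite /dual_fun => <-; rewrite eA IHn.
  - by rewrite (maximaD1 (order_onS _ o') Ud Ue de rde) ?subsetUr.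
  - apply: leq_trans (_ : #|D :|: U| <= n)%N; rewrite // -eA; apply/proper_card/properD1.
    by rewrite inE Ud orbT.
  - by apply: order_onS o; rewrite setUS // subsetDl.
  - by rewrite -cut_opp setUC cut_D1 // setUC.
rewrite (val_antichains V) //; first by rewrite mD mU.
  exact: maxima_antichain.
by move=> x y Ux Uy rxy; apply/esym/(maxima_antichain mU).
Qed.

End Reduction.

Lemma maxima_antichainE (T : finType) (r : rel T) (A : {set T}) :
  antichain r A -> maxima r A = A.
Proof.
move=> aA; apply/setP=> x; rewrite inE; case Ax: (x \in A) => //=.
by apply/forall_inP=> y Ay; apply/implyP=> /(aA _ _ Ax Ay)->.
Qed.

Lemma cutS (T : finType) (r : rel T) (A B D U : {set T}) :
  D :|: U \subset B -> B \subset A -> cut r A D U -> cut r B D U.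
Proof.
move=> sDU /subsetP sBA /cutP[_ dDU dD uU rDU]; apply/cutP; split=> //.
  by move=> d a Dd /sBA; apply: dD.
by move=> u a Uu /sBA; apply: uU.
Qed.

(** * Expanding over free points *)

(** Let [I] consist of points that may lie below or beside the new point, but
    never above it.  If the value is the same constant [c] for every nonempty
    set [E] of points of [I] placed below, and the rest of [I] removed, then
    leaving all of [I] incomparable subtracts [c] once. *)
Section Free.
Variables (k : fieldType) (V : valuation k) (T : finType) (r : rel T).
Variables (D U I : {set T}) (c : k).
Hypothesis o : order_on r (D :|: U :|: I).
Hypothesis cDU : cut r (D :|: U :|: I) D U.
Hypothesis dI : [disjoint I & D :|: U].
Hypothesis aI : antichain r I.
Hypothesis rIU : forall z u, z \in I -> u \in U -> r z u.
Hypothesis nDI : forall z, z \in I -> exists2 d, d \in D & ~~ r d z.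
Hypothesis Vc : forall E : {set T}, E \subset I -> E != set0 ->
  V T r (D :|: U :|: E) (D :|: E) U = c.

Lemma cut_free (E Z : {set T}) : E \subset I -> Z \subset I -> [disjoint E & Z] ->
  cut r (D :|: U :|: E :|: Z) (D :|: E) U.
Proof.
move=> /subsetP sE /subsetP sZ dEZ.
case/cutP: cDU => sA dDU dD uU rDU.
have sEZ a : a \in D :|: U :|: E :|: Z -> a \in D :|: U :|: I.
  by rewrite !inE -orbA => /orP[->|/orP[/sE|/sZ] ->] //; rewrite !orbT.
apply/cutP; split.
- by apply/subsetP=> a; rewrite !inE => /orP[/orP[]|] ->; rewrite ?orbT.
- apply/pred0P=> a /=; rewrite !inE; apply/negP=> /andP[/orP[Da|Ea] Ua].
    by rewrite (disjointFr dDU) in Ua.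
  by have := disjointFr dI (sE a Ea); rewrite !inE Ua orbT.
- move=> d a; rewrite in_setU => /orP[Dd /sEZ Aa rad|Ed Aa rad].
    by rewrite inE (dD d).
  have Id := sE d Ed; have Ad : d \in D :|: U :|: I by rewrite !inE Id orbT.
  rewrite !inE -!orbA in Aa *; case/or4P: Aa => [->|Ua|->|Za]; rewrite ?orbT //.
    by have := disjointFr dI Id; rewrite !inE (uU a d) ?orbT.
  by rewrite (aI (sZ a Za) Id rad) Ed orbT.
- by move=> u a Uu /sEZ; apply: uU.
- by move=> d u; rewrite inE => /orP[/rDU|/sE/rIU]; apply.
Qed.

(** Inserting [z] as an incomparable point subtracts the value with [z] placed
    below, which is [c] for the first inserted point and [0] for the later ones. *)
Lemma val_free_gen (E Z : {set T}) : E \subset I -> Z \subset I -> [disjoint E & Z] ->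
  V T r (D :|: U :|: E :|: Z) (D :|: E) U =
  (if E == set0 then V T r (D :|: U) D U else c) - (if Z == set0 then 0 else c).
Proof.
have [n] := ubnP #|Z|; elim: n => // n IHn in E Z * => leZ sE sZ dEZ.
have [->|[z Zz]] := set_0Vmem Z.
  rewrite eqxx setU0 subr0; case: eqVneq => [->|nE]; first by rewrite !setU0.
  exact: Vc.
have Iz := subsetP sZ z Zz.
have nzDU : z \notin D :|: U by rewrite (disjointFr dI).
have nzE : z \notin E by rewrite (disjointFl dEZ).
have sEZ : D :|: U :|: E :|: Z \subset D :|: U :|: I.
  by rewrite -setUA setUS // subUset sE.
set A := _ :|: Z in sEZ *.
have Az : z \in A by rewrite inE Zz orbT.
have eA : A :\ z = D :|: U :|: E :|: Z :\ z.
  apply/setP=> a; rewrite !inE; case: eqVneq => //= ->.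
  by move: nzDU; rewrite inE => /negPf->; rewrite (negPf nzE).
have sZz : Z :\ z \subset I by apply: subset_trans sZ; apply: subsetDl.
have dEZz : [disjoint E & Z :\ z] by apply: disjointWr dEZ; apply: subsetDl.
have leZz : (#|Z :\ z| < n)%N by move: leZ; rewrite (cardsD1 z Z) Zz add1n ltnS.
have szE : z |: E \subset I by rewrite subUset sub1set Iz.
have dzE : [disjoint z |: E & Z :\ z].
  apply/pred0P=> a /=; rewrite !inE; case: eqVneq => //= _.
  by apply/negP=> /andP[/(disjointFr dEZ)->].
have := val_insert V (order_onS sEZ o) Az _; move=> /(_ (D :|: E) U).
rewrite {1 2}eA => /(_ (cut_free sE sZz dEZz)); rewrite IHn //.
have [d Dd nrdz] := nDI Iz.
have ndz : d != z by apply: contraNneq nzDU => <-; rewrite inE Dd.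
rewrite [X in (X && _)%:R](_ : _ = false) ?add0r; last first.
  apply/eqP=> /setP/(_ d); rewrite [in RHS]inE (negPf nrdz) !andbF.
  by rewrite inE Dd.
rewrite [V T r A _ (z |: U)](val_notcut V) ?addr0; last first.
  apply/negP=> /cutP[_ _ _ _ /(_ d z)].
  by rewrite !inE Dd eqxx (negPf nrdz) => /(_ isT isT).
have -> : z |: (D :|: E) = D :|: (z |: E) by rewrite setUCA.
have {2}-> : A = D :|: U :|: (z |: E) :|: Z :\ z.
  apply/setP=> a; rewrite !inE; case: eqVneq => [->|_] /=; rewrite ?orbT //.
  by rewrite Zz !orbT.
rewrite (IHn (z |: E)) // [z |: E == _](_ : _ = false); last first.
  by apply/eqP=> /setP/(_ z); rewrite !inE eqxx.
have -> : (Z == set0) = false by apply/eqP=> Z0; rewrite Z0 inE in Zz.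
by move/eqP; rewrite -subr_eq => /eqP <-; ring.
Qed.

Lemma val_free : I != set0 -> V T r (D :|: U :|: I) D U = V T r (D :|: U) D U - c.
Proof.
move=> nI; have := @val_free_gen set0 I; rewrite !setU0 sub0set eqxx (negPf nI).
by apply => //; rewrite -setI_eq0 set0I.
Qed.

End Free.

(** * Corner values stabilise at two *)

Section Crown.
Variables (p m q : nat).

(** In order: the points [s_i] and [z_j], the [q] points on top, and the two
    points [x] ([true]) and [y] ([false]) that get exchanged. *)
Definition crown : Type := ('I_p + 'I_m) + ('I_q + bool).
HB.instance Definition _ := Finite.on crown.

Definition crown_lt (a b : crown) : bool :=
  match a, b with
  | inl (inl i), inl (inl _) => false
  | inl (inl i), inl (inr j) => i != j :> nat
  | inl (inr _), inl _ => false
  | inl (inl _), inr _ => true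
  | inl (inr _), inr (inl _) => true
  | inl (inr _), inr (inr b) => b
  | inr (inr _), inr (inl _) => true
  | inr (inr b), inr (inr b') => ~~ b && b'
  | _, _ => false
  end.

Definition crown_le (a b : crown) := (a == b) || crown_lt a b.

Definition lowers : {set crown} := [set a | if a is inl (inl _) then true else false].
Definition middles : {set crown} := [set a | if a is inl (inr _) then true else false].
Definition uppers : {set crown} := [set a | if a is inr (inl _) then true else false].
Definition apex : crown := inr (inr true).
Definition probe : crown := inr (inr false).

Lemma order_on_crown (A : {set crown}) : order_on crown_le A.
Proof.
rewrite /crown_le; split=> [a _|a b _ _|b a c _ _ _]; first by rewrite eqxx.
  case: eqVneq => //=.
  by case: a b => [[i|j]|[l|[]]] [[i'|j']|[l'|[]]] _ /andP[].
case: eqVneq => [->//|_]; case: (eqVneq b c) => [->|_] /=; first by rewrite orbC => ->.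
by case: a b c => [[i|j]|[l|[]]] [[i'|j']|[l'|[]]] [[i''|j'']|[l''|[]]] //=; rewrite orbT.
Qed.

Lemma card_lowers : #|lowers| = p.
Proof.
rewrite -[RHS]card_ord -(card_imset _ (_ : injective (fun i : 'I_p => inl (inl i) : crown))).
  by apply: eq_card => -[[i|j]|[l|b]]; rewrite !inE; apply/esym/imsetP; 
    [exists i | case | case | case].
by move=> i j [].
Qed.

Lemma card_middles : #|middles| = m.
Proof.
rewrite -[RHS]card_ord -(card_imset _ (_ : injective (fun i : 'I_m => inl (inr i) : crown))).
  by apply: eq_card => -[[i|j]|[l|b]]; rewrite !inE; apply/esym/imsetP; 
    [case | exists j | case | case].
by move=> i j [].
Qed.

Lemma card_uppers : #|uppers| = q.
Proof.
rewrite -[RHS]card_ord -(card_imset _ (_ : injective (fun i : 'I_q => inr (inl i) : crown))).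
  by apply: eq_card => -[[i|j]|[l|b]]; rewrite !inE; apply/esym/imsetP; 
    [case | case | exists l | case].
by move=> i j [].
Qed.

Hypotheses (p_gt2 : (2 < p)%N) (m_gt0 : (0 < m)%N) (ltmp : (m < p)%N).

Let lower (j : 'I_m) : crown := inl (inl (widen_ord (ltnW ltmp) j)).

(** One point [z_j] leaves exactly [s_j] uncovered; two of them cover all the
    [s_i], and there are at most [m < p] points [z_j]. *)
Lemma card_maxima_crown (E : {set crown}) : E \subset middles -> E != set0 ->
  (2 <= #|maxima crown_le (lowers :|: E)| < p)%N.
Proof.
move=> /subsetP sE /set0Pn[z Ez]; have Mz := sE z Ez.
case: z => [[i|j]|[l|b]] in Ez Mz *; rewrite inE in Mz => //.
have inlE b : b \in lowers :|: E -> exists s, b = inl s.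
  rewrite inE => /orP[|/sE]; rewrite inE; case: b => [s|[]] // _; by exists s.
have sEm : E \subset maxima crown_le (lowers :|: E).
  apply/subsetP=> a Ea; rewrite !inE Ea orbT /=; apply/forall_inP=> b /inlE[s ->].
  have := sE a Ea; rewrite inE /crown_le eq_sym.
  by case: a {Ea} => [[i|i]|[i|i]] // _; case: eqVneq.
have uncovered (i : 'I_p) (j' : 'I_m) :
    (inl (inl i) : crown) \in maxima crown_le (lowers :|: E) ->
    (inl (inr j') : crown) \in E -> i = j' :> nat.
  rewrite inE => /andP[_ /forall_inP mi] Ej'; apply/eqP/negPn/negP=> ij'.
  by have := mi (inl (inr j')); rewrite inE Ej' orbT /crown_le /= ij' => /(_ isT).
have [E1|/set0Pn[a]] := eqVneq (E :\ inl (inr j)) set0; last first.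
  rewrite !inE => /andP[aj Ea].
  have -> : maxima crown_le (lowers :|: E) = E.
    apply/eqP; rewrite eqEsubset sEm andbT; apply/subsetP=> b mb.
    have : b \in lowers :|: E by move: mb; rewrite inE => /andP[].
    case/setUP=> //; rewrite inE; case: b mb => [[i|i]|[i|i]] // mb _.
    have := sE a Ea; rewrite inE; case: a aj Ea => [[i'|i']|[i'|i']] // aj Ea _.
    case/eqP: aj; congr (inl (inr _)); apply: val_inj => /=.
    by rewrite -(uncovered i i') // (uncovered i j).
  apply/andP; split.
    by rewrite (cardsD1 (inl (inr j))) Ez (cardsD1 a) !inE aj Ea.
  apply: leq_ltn_trans ltmp; rewrite -card_middles; apply: subset_leq_card.
  exact/subsetP.
have -> : maxima crown_le (lowers :|: E) = [set inl (inr j); lower j].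
  apply/setP=> a; apply/idP/idP=> [ma|].
    have : a \in lowers :|: E by move: ma; rewrite inE => /andP[].
    case/setUP=> [|Ea]; last first.
      have := in_set0 a; rewrite -E1 !inE Ea andbT => /negbT; rewrite negbK => ->.
      by [].
    rewrite inE; case: a ma => [[i|i]|[i|i]] // mi _.
    rewrite !inE; apply/orP; right; apply/eqP; congr (inl (inl _)).
    by apply: val_inj; rewrite /= (uncovered i j).
  rewrite !inE => /orP[/eqP->|/eqP->]; first by have := subsetP sEm _ Ez; rewrite !inE.
  rewrite /=; apply/forall_inP=> b; rewrite inE => /orP[|Eb].
    by rewrite inE /crown_le eq_sym; case: b => [[i|i]|[i|i]] //= _; rewrite orbF implybb.
  have := in_set0 b; rewrite -E1 !inE Eb andbT => /negbT; rewrite negbK => /eqP->.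
  by rewrite /crown_le /= eqxx.
by rewrite cards2 p_gt2.
Qed.

Variables (k : fieldType) (V : valuation k).
(** The induction hypothesis under which the expansion of [y] over the [z_j]
    telescopes. *)
Hypothesis IH : forall j l, (2 <= j < p)%N -> corner V j l = corner V 2 l.

(** This covers [y] both before and after [x] has been added: [W] consists of the
    [q] top points, together with [x] in the second case. *)
Lemma val_probe (W : {set crown}) l :
    [disjoint W & lowers :|: middles] -> probe \notin W ->
    #|maxima (opp_rel crown_le) W| = l ->
    (forall a u, u \in W -> crown_le u a -> a \in W) ->
  V crown crown_le (lowers :|: W :|: middles) lowers W = corner V p l - corner V 2 l.
Proof.
move=> dW yW cW uW.
have ltW a u : a \in lowers :|: middles -> u \in W -> crown_le a u.
  move=> La Wu; have := disjointFr dW Wu; move: La; rewrite !inE /crown_le.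
  by case: a u yW Wu => [[i|i]|[i|i]] [[i'|i']|[i'|[]]] //= + Wu; rewrite ?Wu // orbT.
have dLW : [disjoint lowers & W].
  rewrite disjoint_sym; apply: disjointWr dW; exact: subsetUl.
have aL : antichain crown_le lowers.
  move=> a b; rewrite !inE /crown_le; case: a b => [[i|i]|[i|i]] // [[j|j]|[j|j]] // _ _.
  by rewrite orbF => /eqP.
have aM : antichain crown_le middles.
  move=> a b; rewrite !inE /crown_le; case: a b => [[i|i]|[i|i]] // [[j|j]|[j|j]] // _ _.
  by rewrite orbF => /eqP.
have cut0 : cut crown_le (lowers :|: W :|: middles) lowers W.
  apply/cutP; split=> //.
  - exact: subsetUl.
  - move=> d a; rewrite inE /crown_le; case: d a => [[i|i]|[i|i]] // [[j|j]|[j|j]] //; rewrite ?inE //.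
  - by move=> u a Wu _; apply: uW.
  - by move=> d u Ld Wu; apply: ltW; rewrite // inE Ld.
have nzM z : z \in middles -> z \notin lowers by rewrite !inE; case: z => [[]|].
have m0 : middles != set0 by rewrite -card_gt0 card_middles.
have dML : [disjoint middles & lowers :|: W].
  apply/pred0P=> z /=; apply/negP=> /andP[Mz]; rewrite in_setU.
  by rewrite (negPf (nzM z Mz)) => /(disjointFr dW); rewrite in_setU Mz orbT.
have rMW z u : z \in middles -> u \in W -> crown_le z u.
  by move=> Mz; apply: ltW; rewrite in_setU Mz orbT.
have nLM z : z \in middles -> exists2 d, d \in lowers & ~~ crown_le d z.
  by rewrite inE; case: z => [[i|i]|[i|i]] // _; exists (lower i);
    rewrite ?inE // /crown_le /= eqxx.
have oA A : order_on crown_le A by exact: order_on_crown.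
rewrite (val_free (c := corner V 2 l) (oA _) cut0) // => [|E sE E0].
  rewrite val_full //; first by rewrite cW maxima_antichainE // card_lowers.
  by apply: cutS cut0; [apply: subxx|apply: subsetUl].
have := cut_free cut0 dML aM rMW sE (sub0set _) _; rewrite setU0.
rewrite -setI_eq0 setI0 eqxx => /(_ isT).
rewrite setUAC => cE; rewrite val_full // cW IH //.
exact: card_maxima_crown.
Qed.

(** Without [y], the maximal points below [x] are counted by
    [card_maxima_crown]; with [y], they are [y] and the [z_j]. *)
Lemma crown_exchange :
  corner V m.+1 q * (corner V p q - corner V 2 q)
  = corner V 2 q * (corner V p 1 - corner V 2 1).
Proof.
have oA A : order_on crown_le A by exact: order_on_crown.
have xE := @val_exchange _ V _ crown_le setT apex probe (oA _) (in_setT _) (in_setT _) isT.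
have dU : [disjoint uppers & lowers :|: middles].
  by apply/pred0P=> -[[i|i]|[i|i]]; rewrite /= !inE ?andbF.
have dXU : [disjoint apex |: uppers & lowers :|: middles].
  by apply/pred0P=> -[[i|i]|[i|i]]; rewrite /= !inE ?andbF.
have cU : #|maxima (opp_rel crown_le) uppers| = q.
  rewrite maxima_antichainE ?card_uppers //.
  move=> a b; rewrite !inE /opp_rel /crown_le.
  by case: a b => [[i|i]|[i|i]] [[j|j]|[j|j]] // _ _; rewrite orbF => /eqP->.
have cXU : #|maxima (opp_rel crown_le) (apex |: uppers)| = 1%N.
  apply/eqP/cards1P; exists apex; apply/setP=> a; rewrite !inE.
  case: eqVneq => [->|ax] /=.
    apply/forall_inP=> b; rewrite !inE /opp_rel /crown_le.
    by case: b => [[i|i]|[i|b]] //=; rewrite orbF => /eqP->.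
  apply/negP=> /andP[Ua] /forall_inP/(_ apex); rewrite !inE eqxx /opp_rel /crown_le.
  by case: a ax Ua => [[i|i]|[i|i]] //= ax _ /(_ isT).
have uU a u : u \in uppers -> crown_le u a -> a \in uppers.
  rewrite !inE /crown_le; case: u a => [[i|i]|[i|i]] [[j|j]|[j|j]] //= _.
have uXU a u : u \in apex |: uppers -> crown_le u a -> a \in apex |: uppers.
  rewrite !inE /crown_le; case: u a => [[i|i]|[i|[]]] [[j|j]|[j|[]]] //= _.
have cx := cut_point (oA setT) (in_setT apex).
have Txy : apex \in setT :\ probe by rewrite !inE.
have cyx := cut_point (oA _) Txy; move: xE cx cyx.
have -> : below crown_le setT apex = lowers :|: middles :|: [set probe].
  by apply/setP=> -[[i|i]|[i|[]]]; rewrite !inE.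
have -> : above crown_le setT apex = uppers.
  by apply/setP=> -[[i|i]|[i|[]]]; rewrite !inE.
have -> : below crown_le (setT :\ apex) probe = lowers.
  by apply/setP=> -[[i|i]|[i|[]]]; rewrite !inE.
have -> : above crown_le (setT :\ apex) probe = uppers.
  by apply/setP=> -[[i|i]|[i|[]]]; rewrite !inE.
have -> : below crown_le setT probe = lowers.
  by apply/setP=> -[[i|i]|[i|[]]]; rewrite !inE.
have -> : above crown_le setT probe = apex |: uppers.
  by apply/setP=> -[[i|i]|[i|[]]]; rewrite !inE.
have -> : below crown_le (setT :\ probe) apex = lowers :|: middles.
  by apply/setP=> -[[i|i]|[i|[]]]; rewrite !inE.
have -> : above crown_le (setT :\ probe) apex = uppers.
  by apply/setP=> -[[i|i]|[i|[]]]; rewrite !inE.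
have -> : setT :\ apex = lowers :|: middles :|: [set probe] :|: uppers.
  by apply/setP=> -[[i|i]|[i|[]]]; rewrite !inE.
have -> : setT :\ probe = lowers :|: (apex |: uppers) :|: middles.
  by apply/setP=> -[[i|i]|[i|[]]]; rewrite !inE.
have -> : (lowers :|: (apex |: uppers) :|: middles) :\ apex = lowers :|: middles :|: uppers.
  by apply/setP=> -[[i|i]|[i|[]]]; rewrite !inE.
have -> : (lowers :|: middles :|: [set probe] :|: uppers) :\ probe = lowers :|: uppers :|: middles.
  by apply/setP=> -[[i|i]|[i|[]]]; rewrite !inE.
move=> xE cx cyx; move: xE.
rewrite (val_probe dU _ cU uU) ?inE // (val_probe dXU _ cXU uXU) ?inE //.
rewrite !val_full // cU => E; rewrite -[RHS]mulrC.
rewrite [X in _ = _ * X]IH ?card_maxima_crown // -?card_gt0 ?card_middles // in E.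
rewrite -E.
congr (corner V _ q * _).
have -> : maxima crown_le (lowers :|: middles :|: [set probe]) = probe |: middles.
  apply/setP=> a; rewrite !inE; case: a => [[i|j]|[l|b]] //=.
  - apply/negP=> /forall_inP/(_ probe); rewrite !inE eqxx /= => /(_ isT).
    by rewrite /crown_le.
  - apply/forall_inP=> b; rewrite !inE /crown_le.
    by case: b => [[i'|j']|[l'|[]]] //= _; rewrite orbF eq_sym implybb.
  rewrite orbF andb_idr // => /eqP[->]; apply/forall_inP=> a; rewrite !inE /crown_le.
  by case: a => [[i'|j']|[l'|[]]].
by rewrite cardsU1 card_middles !inE.
Qed.

End Crown.

Section Stability.
Variable k : fieldType.

(** The right-hand side of [crown_exchange] is the same for [m = 1] and
    [m = p - 1], and the left-hand sides differ by the square of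
    [corner V p q - corner V 2 q]. *)
Lemma corner_stable_l (V : valuation k) p q : corner V p q = corner V (minn p 2) q.
Proof.
have [n] := ubnP p; elim: n => // n IHn in p q * => ltpn.
have [//|p_gt2] := leqP p 2.
have IH j l : (2 <= j < p)%N -> corner V j l = corner V 2 l.
  by case/andP=> j2 jp; rewrite IHn ?(minn_idPr j2) //; lia.
have p1 : (0 < p.-1 < p)%N by lia.
case/andP: p1 => p1 pp.
have := crown_exchange q p_gt2 p1 pp IH; rewrite prednK; last by lia.
have /= <- := crown_exchange q p_gt2 (isT : 0 < 1)%N (ltnW p_gt2) IH.
by move/eqP; rewrite -subr_eq0 -mulrBl mulf_eq0 orbb subr_eq0 => /eqP.
Qed.

Lemma corner_stable (V : valuation k) p q :
  corner V p q = corner V (minn p 2) (minn q 2).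
Proof. by rewrite corner_stable_l; apply: (corner_stable_l (dual V)). Qed.

End Stability.

(** * Evaluation in terms of corner values *)

(** Formal combinations of corner values, so that evaluations can be computed
    without computing in the field. *)
Inductive expr := Zero | One | Corner of nat & nat | Minus of expr & expr.

Section Evaluation.
Variable T : eqType.
Implicit Types (r : rel T) (A D U I : seq T).

Definition cut_seq r A D U :=
  [&& all [in A] (D ++ U), ~~ has [in U] D,
      all (fun d => all (fun a => r a d ==> (a \in D)) A) D,
      all (fun u => all (fun a => r u a ==> (a \in U)) A) U
    & all (fun d => all (r d) U) D].

Definition maxima_seq r A := [seq x <- A | all (fun y => r x y ==> (y == x)) A].

(** The poset consists of [D], [U] and the points [I] incomparable to the new
    one.  Each step solves the insertion rule for the term in which the first
    point [z] of [I] stays incomparable. *)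
Fixpoint eval r D U I : expr :=
  if cut_seq r (D ++ U ++ I) D U then
    if I is z :: I' then
      let same := all (fun a => ((a \in D) == r a z) && ((a \in U) == r z a))
                      (D ++ U ++ I') in
      Minus (Minus (Minus (eval r D U I') (if same then One else Zero))
               (eval r (z :: D) U I')) (eval r D (z :: U) I')
    else Corner (minn (size (maxima_seq r D)) 2)
                (minn (size (maxima_seq (fun x y => r y x) U)) 2)
  else Zero.

Definition eval_point r A x :=
  let A' := rem x A in
  eval r [seq a <- A' | r a x] [seq a <- A' | ~~ r a x && r x a]
    [seq a <- A' | ~~ r a x && ~~ r x a].

End Evaluation.

Section Soundness.
Variables (k : fieldType) (V : valuation k).

Fixpoint interp (e : expr) : k :=
  match e with
  | Zero => 0
  | One => 1
  | Corner p q => corner V p q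
  | Minus e1 e2 => interp e1 - interp e2
  end.

Variable T : finType.
Implicit Types (r : rel T) (A D U I : seq T).

Lemma cut_seqE r A D U : cut_seq r A D U = cut r [set:: A] [set:: D] [set:: U].
Proof.
apply/and5P/cutP=> -[sA dDU dD uU rDU].
  split.
  - by apply/subsetP=> x; rewrite !inE -mem_cat => /(allP sA).
  - by apply/pred0P=> x /=; rewrite !inE; apply/negP=> /andP[Dx Ux]; move/hasPn/(_ x Dx)/negP: dDU; apply.
  - by move=> d a; rewrite !inE => Dd Aa; move/allP/(_ d Dd)/allP/(_ a Aa)/implyP: dD.
  - by move=> u a; rewrite !inE => Uu Aa; move/allP/(_ u Uu)/allP/(_ a Aa)/implyP: uU.
  - by move=> d u; rewrite !inE => Dd Uu; move/allP/(_ d Dd)/allP/(_ u Uu): rDU.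
split.
- by apply/allP=> x; rewrite mem_cat => DUx; move/subsetP/(_ x): sA; rewrite !inE; apply.
- by apply/hasPn=> x Dx; have := disjointFr dDU; move/(_ x); rewrite !inE => ->.
- by apply/allP=> d Dd; apply/allP=> a Aa; apply/implyP; have := dD d a; rewrite !inE; apply.
- by apply/allP=> u Uu; apply/allP=> a Aa; apply/implyP; have := uU u a; rewrite !inE; apply.
- by apply/allP=> d Dd; apply/allP=> u Uu; have := rDU d u; rewrite !inE; apply.
Qed.

Lemma size_maxima_seq r A : uniq A -> size (maxima_seq r A) = #|maxima r [set:: A]|.
Proof.
move=> uA; rewrite -(card_uniqP (filter_uniq _ uA)); apply: eq_card => x.
rewrite mem_filter !inE andbC; case: (x \in A) => //=.
by apply/allP/forall_inP=> mx y; have := mx y; rewrite !inE.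
Qed.

Lemma eval_sound r D U I :
    order_on r [set:: D ++ U ++ I] -> uniq (D ++ U ++ I) ->
  V T r [set:: D ++ U ++ I] [set:: D] [set:: U] = interp (eval r D U I).
Proof.
elim: I => [|z I IHI] in D U *.
  rewrite /= cut_seqE cats0 => o u.
  case: ifP => c; last by rewrite (val_notcut V) // c.
  have eDU : [set:: D ++ U] = [set:: D] :|: [set:: U].
    by apply/setP=> x; rewrite !inE mem_cat.
  rewrite eDU in o c *; move: u; rewrite cat_uniq => /and3P[uD _ uU].
  by rewrite (val_full V o c) /= !size_maxima_seq // -corner_stable.
have perm_z X Y : perm_eq (X ++ z :: Y) (z :: X ++ Y).
  by rewrite -[z :: Y]cat1s perm_catCA.
set A := [set:: D ++ U ++ z :: I] => o u.
rewrite /= cut_seqE; case: ifP => c; last by rewrite (val_notcut V) // c.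
have [zI uI] : z \notin D ++ U ++ I /\ uniq (D ++ U ++ I).
  apply/andP; rewrite -[_ && _]/(uniq (z :: _)).
  by move: u; rewrite !catA (perm_uniq (perm_z _ _)).
have memA x : (x \in A) = (x == z) || (x \in D ++ U ++ I).
  by rewrite inE !catA (perm_mem (perm_z _ _)) inE.
have eA : A :\ z = [set:: D ++ U ++ I].
  apply/setP=> x; rewrite in_setD1 memA inE.
  by case: eqVneq => // ->; apply/esym/negbTE.
have zA : z \in A by rewrite memA eqxx.
have eD : [set:: z :: D] = z |: [set:: D] by apply/setP=> x; rewrite !inE.
have eU : [set:: z :: U] = z |: [set:: U] by apply/setP=> x; rewrite !inE.
have eAD : [set:: (z :: D) ++ U ++ I] = A.
  by apply/setP=> x; rewrite memA !inE.
have eAU : [set:: D ++ (z :: U) ++ I] = A.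
  by apply/setP=> x; rewrite memA inE (perm_mem (perm_z D (U ++ I))) inE.
have cI : cut r (A :\ z) [set:: D] [set:: U].
  case/cutP: c => sA dDU dD uU rDU; apply/cutP; split=> //.
  - rewrite eA; apply/subsetP=> x; rewrite !inE !mem_cat => /orP[->|->] //.
    by rewrite orbT.
  - by move=> d a Dd; rewrite in_setD1 => /andP[_]; apply: dD.
  - by move=> d a Dd; rewrite in_setD1 => /andP[_]; apply: uU.
have uD : uniq ((z :: D) ++ U ++ I) by rewrite /= zI.
have uU : uniq (D ++ (z :: U) ++ I) by rewrite (perm_uniq (perm_z D (U ++ I))).
have := val_insert V o zA cI.
rewrite {1}eA (IHI D U) //; last by rewrite -eA; apply: order_onS o; apply: subsetDl.
have := IHI (z :: D) U; rewrite eAD eD => /(_ o uD) ->.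
have := IHI D (z :: U); rewrite eAU eU => /(_ o uU) ->.
move=> /= ->.
rewrite (_ : all _ _ = ([set:: D] == below r A z) && ([set:: U] == above r A z)).
  by case: ifP => _ /=; ring.
have ne_z a : a \in D ++ U ++ I -> a != z by apply: contraTneq => ->.
apply/allP/andP=> [same|[/eqP/setP sD /eqP/setP sU] a DUIa].
  have same_a (B : seq T) (P : pred T) : {subset B <= D ++ U ++ I} ->
      (forall a, a \in D ++ U ++ I -> (a \in B) = P a) ->
      [set:: B] == [set a in A | (a != z) && P a].
    move=> sB eB; apply/eqP/setP=> a; rewrite !inE -[a \in _ ++ _ ++ _ :: _]inE.
    rewrite -/A memA.
    have [DUIa|DUI'a] := boolP (a \in D ++ U ++ I).
      by rewrite eB // ne_z // orbT.
    by rewrite orbF andbA andbN /=; apply: contraNF DUI'a; apply: sB.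
  split; apply: same_a => a; first by rewrite mem_cat => ->.
  - by move=> /same/andP[/eqP].
  - by rewrite !mem_cat => ->; rewrite orbT.
  - by move=> /same/andP[_ /eqP].
have Aa : a \in A by rewrite memA DUIa orbT.
have := sD a; have := sU a; rewrite !inE ne_z // -[a \in _ ++ _ ++ _ :: _]inE -/A Aa /=.
by move=> -> ->; rewrite !eqxx.
Qed.

Lemma eval_point_sound r A x :
    order_on r [set:: A] -> uniq A -> x \in A ->
  V T r ([set:: A] :\ x) (below r [set:: A] x) (above r [set:: A] x)
  = interp (eval_point r A x).
Proof.
move=> o uA Ax; rewrite /eval_point.
set A' := rem x A; set D := filter _ _; set U := filter _ _; set I := filter _ _.
have uA' : uniq A' by apply: rem_uniq.
have memA' a : (a \in A') = (a != x) && (a \in A) by rewrite mem_rem_uniq.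
have p : perm_eq (D ++ U ++ I) A'.
  rewrite perm_sym -(perm_filterC (fun a => r a x)) perm_cat2l.
  rewrite -(perm_filterC (fun a => r x a)) -!filter_predI perm_cat //.
    by apply/permP=> P; congr (count _ _); apply: eq_filter => a /=; rewrite andbC.
  by apply/permP=> P; congr (count _ _); apply: eq_filter => a /=; rewrite andbC.
have eA : [set:: A] :\ x = [set:: D ++ U ++ I].
  by apply/setP=> a; rewrite !inE (perm_mem p) memA'.
rewrite -eval_sound -?eA //; last by rewrite (perm_uniq p).
  congr (V T r _ _ _); apply/setP=> a; rewrite !inE mem_filter memA'.
    by rewrite andbC -!andbA andbCA.
  case Aa: (a \in A) => //=; last by rewrite !andbF.
  have [//|ax] := eqVneq a x; first by rewrite !andbF.
  rewrite !andbT /=; case rxa: (r x a); rewrite ?andbF // andbT.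
  apply/esym/negP=> rax; case: o => _ /(_ a x) ra _.
  by case/eqP: ax; apply: ra; rewrite ?inE ?Ax ?Aa ?rax.
by apply: order_onS o; apply: subsetDl.
Qed.
End Soundness.

Section Uniq.
Variable k : fieldType.
(** Both valuations are the interpretation of one and the same expression. *)
Lemma valuation_unique (V V' : valuation k) (T : finType) (r : rel T) A D U :
    (forall p q, corner V p q = corner V' p q) -> order_on r A ->
  V T r A D U = V' T r A D U.
Proof.
move=> eN o; have [c|c] := boolP (cut r A D U); last by rewrite !val_notcut.
case/cutP: (c) => sA dDU _ _ _.
pose I := A :\: (D :|: U).
have eA : A = [set:: enum D ++ enum U ++ enum I].
  apply/setP=> x; rewrite !inE !mem_cat !mem_enum !inE.
  move/subsetP/(_ x): sA; rewrite !inE.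
  by case: (x \in D); case: (x \in U) => //= H; rewrite ?H.
have u : uniq (enum D ++ enum U ++ enum I).
  rewrite !cat_uniq !enum_uniq /= andbT has_cat negb_or -!andbA; apply/and3P; split.
  - by apply/hasPn=> x; rewrite !mem_enum => Ux; rewrite (disjointFl dDU).
  - by apply/hasPn=> x; rewrite !mem_enum !inE negb_or => /andP[/andP[]].
  - by apply/hasPn=> x; rewrite !mem_enum !inE negb_or => /andP[/andP[]].
have eval_V (W : valuation k) : W T r A D U = interp W (eval r (enum D) (enum U) (enum I)).
  by rewrite -eval_sound -?eA // !set_enum.
rewrite !eval_V; elim: (eval _ _ _ _) => //= e1 -> e2 -> //.
Qed.
End Uniq.

(** * Exchange relations in small posets *)

Definition order_seq (T : eqType) (r : rel T) (A : seq T) :=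
  [&& all (fun x => r x x) A,
      all (fun x => all (fun y => r x y && r y x ==> (x == y)) A) A
    & all (fun x => all (fun y => all (fun z => r x y && r y z ==> r x z) A) A) A].

Section Exchange.
Variables (k : fieldType) (V : valuation k).

Lemma order_seqE (T : finType) (r : rel T) A : order_seq r A -> order_on r [set:: A].
Proof.
case/and3P=> rr ra rt; split.
- by move=> x; rewrite inE => /(allP rr).
- move=> x y; rewrite !inE => Ax Ay rxy.
  by apply/eqP; move: rxy; apply/implyP; move/allP/(_ x Ax)/allP/(_ y Ay): ra.
- move=> y x z; rewrite !inE => Ay Ax Az rxy ryz.
  by move/allP/(_ x Ax)/allP/(_ y Ay)/allP/(_ z Az): rt; rewrite rxy ryz.
Qed.

(** Written out point by point so that evaluations reduce by computation. *)
Definition seven : seq 'I_7 :=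
  [:: @Ordinal 7 0 isT; @Ordinal 7 1 isT; @Ordinal 7 2 isT; @Ordinal 7 3 isT;
      @Ordinal 7 4 isT; @Ordinal 7 5 isT; @Ordinal 7 6 isT].

Definition rel_of (lt : rel nat) : rel 'I_7 := fun i j => (val i == val j) || lt (val i) (val j).

Definition exchange_expr (T : eqType) (r : rel T) A x y :=
  ((eval_point r A x, eval_point r (rem x A) y), (eval_point r A y, eval_point r (rem y A) x)).

Definition exchange_at (e : (expr * expr) * (expr * expr)) :=
  interp V e.1.1 * interp V e.1.2 = interp V e.2.1 * interp V e.2.2.

Lemma exchange_sound (T : finType) (r : rel T) A x y e :
  [&& uniq A, x \in A, y \in A, x != y & order_seq r A] ->
  exchange_expr r A x y = e -> exchange_at e.
Proof.
case/and5P=> uA Ax Ay xy /order_seqE o <-; rewrite /exchange_at /=.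
have rem_set z : [set:: A] :\ z = [set:: rem z A].
  by apply/setP=> a; rewrite !inE mem_rem_uniq // inE.
have o' z : order_on r [set:: rem z A].
  by rewrite -rem_set; apply: order_onS o; apply: subsetDl.
rewrite -!eval_point_sound ?rem_uniq ?mem_rem_uniq ?inE ?Ax ?Ay ?andbT // 1?eq_sym //.
by rewrite -!rem_set; apply: val_exchange; rewrite ?inE.
Qed.

End Exchange.

(** Brings the exchange of the points [x] and [y] of the poset [0, ..., n - 1]
    ordered by [lt] into the goal.  The evaluations are computed once, when the
    tactic runs; the order axioms are checked by computation. *)
Ltac exchange V lt n x y :=
  let r := constr:(rel_of lt) in
  let A := constr:(take n seven) in
  let x' := eval vm_compute in (nth (@Ordinal 7 0 isT) seven x) in
  let y' := eval vm_compute in (nth (@Ordinal 7 0 isT) seven y) in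
  let e := eval vm_compute in (exchange_expr r A x' y') in
  let H := fresh in
  have H : exchange_at V e;
   [ apply: (@exchange_sound _ V _ r A x' y'); vm_compute; reflexivity
   | rewrite /exchange_at /= in H; move: H ].

(** An ordinal sum of antichains: the list gives the layer of each point. *)
Definition layers_lt (l : seq nat) : rel nat := fun i j => (nth 0 l i < nth 0 l j)%N.
Definition pairs_lt (l : seq (nat * nat)) : rel nat := fun i j => (i, j) \in l.

Lemma subr_eq0_eq (V : zmodType) (x y : V) : x = y -> x - y = 0.
Proof. by move->; rewrite subrr. Qed.

Ltac exchange_ring V lt n x y :=
  let H := fresh in
  exchange V lt n x y; intro H;
  first [ refine (etrans _ (subr_eq0_eq H)); ring
        | refine (etrans _ (subr_eq0_eq (esym H))); ring ].

Section Relations.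
Variables (k : fieldType) (V : valuation k).
Local Notation N := (corner V).

(** Two consecutive singleton layers between [p] points below and [q] points above. *)
Lemma exchange_twins p q : (p <= 2)%N -> (q <= 2)%N -> N p q * (N 1 q - N p 1) = 0.
Proof.
case: p => [|[|[|//]]] _; case: q => [|[|[|//]]] _; do ?ring.
- exchange_ring V (layers_lt [:: 0; 1]%N) 2%N 0%N 1%N.
- exchange_ring V (layers_lt [:: 0; 1; 2]%N) 3%N 0%N 1%N.
- exchange_ring V (layers_lt [:: 0; 1; 2; 2]%N) 4%N 0%N 1%N.
- exchange_ring V (layers_lt [:: 0; 1; 2]%N) 3%N 1%N 2%N.
- exchange_ring V (layers_lt [:: 0; 1; 2; 3; 3]%N) 5%N 1%N 2%N.
- exchange_ring V (layers_lt [:: 0; 0; 1; 2]%N) 4%N 2%N 3%N.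
- exchange_ring V (layers_lt [:: 0; 0; 1; 2; 3]%N) 5%N 2%N 3%N.
- exchange_ring V (layers_lt [:: 0; 0; 1; 2; 3; 3]%N) 6%N 2%N 3%N.
Qed.

(** Two twins above [p] points, and a roof over them below [q] points: the roof is
    exchanged with one of the twins.  The value of a twin beside the other one is
    obtained by subtracting the cases where they are equal or comparable. *)
Lemma exchange_roof p q : (p <= 1)%N -> (q <= 2)%N ->
  N 2 q * (N p q - 1 - N p 1 - N 1 q) = - (N 1 q * (1 + N 1 1)).
Proof.
move=> p1 q2; apply/eqP; rewrite -subr_eq0; apply/eqP; move: p1 q2.
case: p => [|[|//]] _; case: q => [|[|[|//]]] _.
- exchange_ring V (layers_lt [:: 0; 0; 1]%N) 3%N 2%N 0%N.
- exchange_ring V (layers_lt [:: 0; 0; 1; 2]%N) 4%N 2%N 0%N.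
- exchange_ring V (layers_lt [:: 0; 0; 1; 2; 2]%N) 5%N 2%N 0%N.
- exchange_ring V (layers_lt [:: 0; 1; 1; 2]%N) 4%N 3%N 1%N.
- exchange_ring V (layers_lt [:: 0; 1; 1; 2; 3]%N) 5%N 3%N 1%N.
- exchange_ring V (layers_lt [:: 0; 1; 1; 2; 3; 3]%N) 6%N 3%N 1%N.
Qed.

(** The points [0 < 1 < 3] and [2 < 3]: the tip [3] is exchanged with [1], which is
    beside [2]. *)
Lemma exchange_fork : N 2 0 * (N 1 0 - N 2 0 - N 1 1 + N 2 1) = 0.
Proof.
exchange_ring V (pairs_lt [:: (0, 1); (1, 3); (0, 3); (2, 3)]%N) 4%N 3%N 1%N.
Qed.

(** The zigzag [4 > 0 < 2 > 1 < 3], where the end [4] is exchanged with its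
    neighbour [0]. *)
Lemma exchange_zigzag :
  (N 0 1 - N 0 2 - N 1 1 + N 1 2) * (N 1 0 - N 2 0 - N 1 1 + N 2 1) = 0.
Proof.
exchange_ring V (pairs_lt [:: (0, 2); (0, 4); (1, 2); (1, 3)]%N) 5%N 0%N 4%N.
Qed.

(** The points [0, 2 < 3 < 5, 6] and the chain [1 < 4] between [0] and [5, 6],
    beside [2] and [3]; its two points are exchanged.  When [corner V 1 1 = -1], this
    relation ties [corner V 2 2] to its two neighbours. *)
Lemma exchange_seven :
  (N 1 1 - N 1 2 - N 1 2 + N 2 2) * (N 1 2 + N 2 1 - N 1 1 - N 2 2) = 0.
Proof.
exchange_ring V (pairs_lt [:: (0, 1); (0, 3); (0, 4); (0, 5); (0, 6); (1, 4); (1, 5);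
  (1, 6); (2, 3); (2, 5); (2, 6); (3, 5); (3, 6); (4, 5); (4, 6)]%N) 7%N 1%N 4%N.
Qed.

End Relations.

(** * Classification of the matrices *)

Section Classification.
Variable k : fieldType.
Implicit Types (N : 'M[k]_3) (a b c d e f g h i : k).

Definition listed_mx N :=
  [\/ exists s t : k, N = mxA s t,
      exists t : k, exists2 M : 'M[k]_3, M \in mxBs t & N = M \/ N = M^T
    | exists2 M : 'M[k]_3, M \in mxCs k & N = M \/ N = M^T].

(** The first family is symmetric and the other lists contain the transposes. *)
Lemma listed_mx_tr N : listed_mx N^T -> listed_mx N.
Proof.
case=> [[s [t Nst]]|[t [M tM NM]]|[M CM NM]].
- constructor 1; exists s, t; rewrite -[N]trmxK Nst.
  apply/matrixP=> i j; rewrite !mxE.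
  by case: i j => [[|[|[|//]]] ?] [[|[|[|//]]] ?].
- constructor 2; exists t, M => //.
  by case: NM => NM; [right|left]; rewrite -[N]trmxK NM ?trmxK.
- constructor 3; exists M => //.
  by case: NM => NM; [right|left]; rewrite -[N]trmxK NM ?trmxK.
Qed.

(** Cancelling [1 + e] identifies row [2] with row [1] and column [2] with
    column [1]; the rest is decided by whether [b] and [d] are [0] or [e]. *)
Lemma generic_mx a b c d e f g h i :
    1 + e != 0 ->
    (e - h) * (1 + e) = 0 -> (e - f) * (1 + e) = 0 ->
    (d - g) * (1 + e) = 0 -> (b - c) * (1 + e) = 0 ->
    i * (c - 1 - b - f) = - (f * (1 + e)) ->
    g * (a - 1 - d - b) = - (d * (1 + e)) ->
    b * (e - b) = 0 -> d * (d - e) = 0 -> a * (d - b) = 0 ->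
  listed_mx (mx3 [:: [:: a; b; c]; [:: d; e; f]; [:: g; h; i]]).
Proof.
move=> e1 eh ef dg bc ri rg rb rd ra.
have cancel x y : (x - y) * (1 + e) = 0 -> y = x.
  by move/eqP; rewrite mulf_eq0 (negPf e1) orbF subr_eq0 => /eqP.
rewrite {}(cancel _ _ bc) {}(cancel _ _ eh) {}(cancel _ _ ef) {}(cancel _ _ dg) in ri rg *.
have ei : i = e.
  by apply: cancel; rewrite mulrBl -[e * _]opprK -ri; ring.
rewrite {}ei {ri}.
have [e0|e0] := eqVneq e 0.
  have -> : b = 0 by apply/eqP; move/eqP: rb; rewrite e0 sub0r mulrN oppr_eq0 mulf_eq0 orbb.
  have -> : d = 0 by apply/eqP; move/eqP: rd; rewrite e0 subr0 mulf_eq0 orbb.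
  by constructor 1; exists 0, a; rewrite e0.
move/eqP: rb; rewrite mulf_eq0 subr_eq0 => /orP[/eqP b0|/eqP eb];
  move/eqP: rd; rewrite mulf_eq0 subr_eq0 => /orP[/eqP d0|/eqP de].
- by constructor 1; exists e, a; rewrite b0 d0.
- constructor 2; exists e, (mxB2 e); first by rewrite !inE eqxx ?orbT.
  have a0 : a = 0 by move/eqP: ra; rewrite b0 de subr0 mulf_eq0 (negPf e0) orbF => /eqP.
  right; rewrite a0 b0 de; apply/matrixP=> i' j'; rewrite !mxE.
  by case: i' j' => [[|[|[|//]]] ?] [[|[|[|//]]] ?].
- constructor 2; exists e, (mxB2 e); first by rewrite !inE eqxx ?orbT.
  have a0 : a = 0 by move/eqP: ra; rewrite d0 -eb sub0r mulrN oppr_eq0 mulf_eq0 (negPf e0) orbF => /eqP.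
  by left; rewrite a0 d0 -eb.
constructor 2; exists e, (mxB1 e); first by rewrite !inE eqxx.
have ae : a = e.
  apply: (mulfI e0); rewrite de -{}eb in rg.
  by apply/eqP; rewrite -subr_eq0 -(subrr (- (e * (1 + e)))) -{1}rg; apply/eqP; ring.
by left; rewrite ae -eb de.
Qed.

Lemma tr_mx3 a b c d e f g h i :
  (mx3 [:: [:: a; b; c]; [:: d; e; f]; [:: g; h; i]])^T
  = mx3 [:: [:: a; d; g]; [:: b; e; h]; [:: c; f; i]] :> 'M[k]_3.
Proof.
apply/matrixP=> x y; rewrite !mxE.
by case: x y => [[|[|[|//]]] ?] [[|[|[|//]]] ?].
Qed.

(** The shapes are tried in turn; membership in a listed family is syntactic once
    the entries are the literals [0], [1] and [-1] and one free parameter. *)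
Ltac find_B t M :=
  constructor 2; exists t, M; [by rewrite !inE eqxx ?orbT | ];
  (left; reflexivity) || (right; rewrite tr_mx3; reflexivity).
Ltac find_C M :=
  constructor 3; exists M; [by rewrite !inE eqxx ?orbT | ];
  (left; reflexivity) || (right; rewrite tr_mx3; reflexivity).
Ltac find_listed a :=
  first [ constructor 1; exists (-1), a; reflexivity
        | find_B a (mxB1 a) | find_B (-1 : k) (mxB2 (-1 : k)) | find_B a (mxB3 a)
        | find_B a (mxB4 a) | find_B a (mxB5 a)
        | find_C (mxC1 k) | find_C (mxC2 k) | find_C (mxC3 k) | find_C (mxC4 k)
        | find_C (mxC5 k) | find_C (mxC6 k) | find_C (mxC7 k) | find_C (mxC8 k) ].

Definition bit b := b = 0 \/ b = -1.

(** The four neighbours [b], [d], [f], [h] of the centre leave at most two values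
    for [g] and determine [a] unless it is a free parameter, hence finitely many
    cases. *)
Lemma special_mx_half a b d f g h :
    bit b -> bit d -> bit f -> bit h ->
    (a = 1 + b + d \/ [/\ d = b, 1 + b + f = 0 & g = 0]) ->
    (g = 1 + d + h \/ g = 0 /\ 1 + f + h = 0) ->
  listed_mx (mx3 [:: [:: a; b; 1 + b + f]; [:: d; -1; f]; [:: g; h; 1 + f + h]]).
Proof.
have opp (x y : k) : 1 + x + y = 0 -> y = - (1 + x).
  by move/eqP; rewrite addrC addr_eq0 => /eqP.
pose simp := (addr0, add0r, subrr, subr0, oppr0, opprK).
move=> bb bd bf bh [->|[-> uf g0]] [gw|[g0' iz]].
- case: bb bd bf bh gw => -> [] -> [] -> [] -> ->; rewrite ?simp;
    first [find_listed (0 : k) | find_listed (1 : k) | find_listed (-1 : k)].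
- rewrite g0' iz (opp _ _ iz); case: bb bd bf {bh iz} => -> [] -> [] ->; rewrite ?simp;
    first [find_listed (0 : k) | find_listed (1 : k) | find_listed (-1 : k)].
- rewrite g0 in gw *; rewrite uf (opp _ _ uf) (opp _ _ (esym gw)).
  by case: bb => ->; rewrite ?simp; find_listed a.
- rewrite g0 uf iz (opp _ _ iz) (opp _ _ uf).
  by case: bb => ->; rewrite ?simp; find_listed a.
Qed.

(** The corner [c] is tied to its two neighbours by the defect
    [1 + b + f - c], and [g] by [1 + d + h - g].  The product of the defects
    vanishes, so up to transposition the first one is zero. *)
Lemma special_mx a b c d f g h i :
    bit b -> bit d -> bit f -> bit h ->
    a * (d - b) = 0 -> c * (a - 1 - d - b) = 0 -> g * (a - 1 - b - d) = 0 ->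
    c * (1 + b + f - c) = 0 -> g * (1 + d + h - g) = 0 ->
    (1 + b + f - c) * (1 + d + h - g) = 0 ->
    i * (1 + b + f - c) = 0 -> i * (1 + d + h - g) = 0 -> i = 1 + f + h ->
  listed_mx (mx3 [:: [:: a; b; c]; [:: d; -1; f]; [:: g; h; i]]).
Proof.
wlog u : a b c d f g h i / 1 + b + f - c = 0.
  move=> IH bb bd bf bh ra rca rga ru rw uw iu iw ei.
  move/eqP: (uw); rewrite mulf_eq0 => /orP[/eqP u|/eqP w]; first exact: IH.
  apply: listed_mx_tr; rewrite tr_mx3; apply: IH => //.
  - by rewrite -[RHS]oppr0 -ra; ring.
  - by rewrite mulrC.
  - by rewrite ei addrAC.
move=> bb bd bf bh ra rca rga _ rw _ _ iw ei.
have ec : c = 1 + b + f by apply/esym/eqP; rewrite -subr_eq0 u.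
have gw : g = 1 + d + h \/ g = 0 /\ 1 + f + h = 0.
  have [w|w] := eqVneq (1 + d + h - g) 0; [left|right].
    by apply/esym/eqP; rewrite -subr_eq0 w.
  have zero x : x * (1 + d + h - g) = 0 -> x = 0.
    by move/eqP; rewrite mulf_eq0 (negPf w) orbF => /eqP.
  by rewrite -ei; split; apply: zero.
rewrite ei ec; apply: special_mx_half => //; rewrite -ec.
have [ea|na] := eqVneq (a - 1 - b - d) 0.
  by left; apply/eqP; rewrite -subr_eq0 -ea; apply/eqP; ring.
have zero x : x * (a - 1 - b - d) = 0 -> x = 0.
  by move/eqP; rewrite mulf_eq0 (negPf na) orbF => /eqP.
right; split; [|by apply: zero; rewrite -rca; ring|exact: zero].
move/eqP: ra; rewrite mulf_eq0 subr_eq0 => /orP[/eqP a0|/eqP->//].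
case: bb bd na => -> [] ->; rewrite a0 => //; rewrite ?subr0 ?opprK ?sub0r ?addNr ?eqxx //.
Qed.

End Classification.

Lemma classification (k : fieldType) (V : valuation k) :
  listed_mx (\matrix_(p < 3, q < 3) corner V p q).
Proof.
pose N := corner V.
have -> : \matrix_(p < 3, q < 3) N p q
    = mx3 [:: [:: N 0 0; N 0 1; N 0 2]; [:: N 1 0; N 1 1; N 1 2]; [:: N 2 0; N 2 1; N 2 2]] .
  apply/matrixP=> x y; rewrite !mxE.
  by case: x y => [[|[|[|//]]] ?] [[|[|[|//]]] ?].
have tw p q : (p <= 2)%N -> (q <= 2)%N -> N p q * (N 1 q - N p 1) = 0 := @exchange_twins k V p q.
have ro p q : (p <= 1)%N -> (q <= 2)%N ->
  N 2 q * (N p q - 1 - N p 1 - N 1 q) = - (N 1 q * (1 + N 1 1)) := @exchange_roof k V p q.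
have ro' p q : (p <= 1)%N -> (q <= 2)%N ->
  N q 2 * (N q p - 1 - N 1 p - N q 1) = - (N q 1 * (1 + N 1 1)) := @exchange_roof k (dual V) p q.
have [e1|e1] := eqVneq (1 + N 1 1) 0; last first.
  apply: generic_mx => //.
  - by have := ro 1%N 1%N isT isT => /(congr1 -%R); rewrite opprK => E; rewrite mulrBl -[N 1 1 * _]E; ring.
  - by have := ro' 1%N 1%N isT isT => /(congr1 -%R); rewrite opprK => E; rewrite mulrBl -[N 1 1 * _]E; ring.
  - by have := ro 1%N 0%N isT isT => /(congr1 -%R); rewrite opprK => E; rewrite mulrBl -[N 1 0 * _]E; ring.
  - by have := ro' 1%N 0%N isT isT => /(congr1 -%R); rewrite opprK => E; rewrite mulrBl -[N 0 1 * _]E; ring.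
  - by rewrite -(ro 0%N 2%N isT isT).
  - by rewrite -(ro 0%N 0%N isT isT); ring.
  - exact: (tw 0%N 1%N).
  - exact: (tw 1%N 0%N).
  - exact: (tw 0%N 0%N).
have e : N 1 1 = -1 by apply/eqP; rewrite -addr_eq0 addrC e1.
have bitE (x : k) : x * (1 + x) = 0 -> bit x.
  by move/eqP; rewrite mulf_eq0 addrC addr_eq0 => /orP[] /eqP; [left|right].
have bb : bit (N 0 1).
  by apply: bitE; rewrite -[RHS]oppr0 -(tw 0%N 1%N) // e; ring.
have bd : bit (N 1 0) by apply: bitE; rewrite -(tw 1%N 0%N) // e; ring.
have bf : bit (N 1 2) by apply: bitE; rewrite -(tw 1%N 2%N) // e; ring.
have bh : bit (N 2 1).
  by apply: bitE; rewrite -[RHS]oppr0 -(tw 2%N 1%N) // e; ring.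
have fork : N 2 0 * (1 + N 1 0 + N 2 1 - N 2 0) = 0.
  by rewrite -(exchange_fork V) -/N e; ring.
have fork' : N 0 2 * (1 + N 0 1 + N 1 2 - N 0 2) = 0.
  by rewrite -(exchange_fork (dual V)) /= -/N e; ring.
(* The relation and its dual leave [N 2 2 = 1 + 2 N 1 2 = 1 + 2 N 2 1] as the only
   alternative; then the twin relation at [(2, 2)] makes [N 2 2] vanish unless
   [N 1 2 = N 2 1], but [1 + 2 N 1 2] is [1] or [-1]. *)
have ei : N 2 2 = 1 + N 1 2 + N 2 1.
  apply/eqP; apply/negPn/negP=> ne.
  have i_eq x : (N 1 1 - x - x + N 2 2) * (N 1 2 + N 2 1 - N 1 1 - N 2 2) = 0 -> N 2 2 = 1 + x + x.
    move/eqP; rewrite mulf_eq0 e => /orP[] /eqP E; last first.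
      by case/eqP: ne; apply/eqP; rewrite eq_sym -subr_eq0 -E; apply/eqP; ring.
    by apply/eqP; rewrite -subr_eq0 -E; apply/eqP; ring.
  have i1 : N 2 2 = 1 + N 1 2 + N 1 2 by apply: i_eq; apply: exchange_seven.
  have i2 : N 2 2 = 1 + N 2 1 + N 2 1.
    by apply: i_eq; rewrite -[RHS](exchange_seven (dual V)) /= -/N; ring.
  have := tw 2%N 2%N isT isT; move/eqP; rewrite mulf_eq0 subr_eq0.
  case/orP=> /eqP; last by move=> fh; rewrite fh -i2 eqxx in ne.
  rewrite i1; case: bf => -> /eqP; rewrite ?addr0 ?subrr ?sub0r ?oppr_eq0 oner_eq0 //.
rewrite e; apply: special_mx => //.
- exact: (tw 0%N 0%N).
- have := ro' 0%N 0%N isT isT; rewrite e1 mulr0 oppr0 => <-; ring.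
- have := ro 0%N 0%N isT isT; rewrite e1 mulr0 oppr0 => <-; ring.
- by rewrite -(exchange_zigzag V) -/N e; ring.
- by have := ro 0%N 2%N isT isT; rewrite e1 mulr0 oppr0 => E; rewrite -[RHS]oppr0 -E; ring.
- by have := ro' 0%N 2%N isT isT; rewrite e1 mulr0 oppr0 => E; rewrite -[RHS]oppr0 -E; ring.
Qed.

(** * Embeddings are built one point at a time *)

(** Every embedding is a bijection or misses some point [x] of its target, and
    then it factors through the embedding that adds [x] last. *)
Lemma measure_ext (k : fieldType) (mu nu : measure k) :
    (forall (Q : poset) (x : Q), measure_marked x mu = measure_marked x nu) ->
  forall (P Q : poset) (a : embedding P Q), mu P Q a = nu P Q a.
Proof.
move=> eq_marked P Q; have [n] := ubnP #|Q|; elim: n => // n IHn in Q * => leQ a.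
have [x ax|onto] := pickP (fun x => x \notin codom a); last first.
  have ba : bijective a.
    apply: inj_card_bij (@emb_inj _ _ a) _; rewrite -(card_codom (@emb_inj _ _ a)).
    by apply/subset_leq_card/subsetP=> x _; apply: negbFE; apply: onto.
  by rewrite !measure_iso.
have ne_x p : a p != x by apply: contraNneq ax => <-; apply: codom_f.
pose a' := [ffun p => Sub (a p) (ne_x p) : point_del x].
have a'E : is_embedding a'.
  apply/is_embeddingP; split=> p p'; rewrite !ffunE.
    by move/(congr1 val) => /= /emb_inj.
  by rewrite leEsub /= -emb_le.
have -> : a = emb_comp (point_del_emb x) (Embedding a'E).
  by apply/val_inj/ffunP=> p; rewrite /= !ffunE.
rewrite !measure_comp; congr (_ * _); first exact: eq_marked.
apply: IHn; rewrite -ltnS; apply: leq_trans leQ; rewrite ltnS card_sig.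
by apply: proper_card; apply/properP; split; [apply/subsetP|exists x; rewrite // !inE eqxx].
Qed.

Theorem theorem5p1 (k : fieldType) (nu : measure k) :
  [/\ (forall p q : nat, nuJ nu p q = nuJ nu (minn p 2) (minn q 2)),
      (forall mu : measure k, nuJ_mx mu = nuJ_mx nu ->
         forall (P Q : poset) (a : embedding P Q), mu P Q a = nu P Q a)
    & [\/ exists s t : k, nuJ_mx nu = mxA s t,
          exists t : k, exists2 M : 'M[k]_3,
            M \in mxBs t & nuJ_mx nu = M \/ nuJ_mx nu = M^T
        | exists2 M : 'M[k]_3,
            M \in mxCs k & nuJ_mx nu = M \/ nuJ_mx nu = M^T]].
Proof.
split; first exact: (corner_stable (valuation_of_measure nu)).
- move=> mu eN; apply: measure_ext => Q x; rewrite !measure_marked_value.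
  apply: (valuation_unique (V := valuation_of_measure mu) (V' := valuation_of_measure nu)).
    move=> p q; rewrite corner_stable [RHS]corner_stable /=.
    have /matrixP/(_ (inord (minn p 2)) (inord (minn q 2))) := eN.
    by rewrite !mxE !inordK ?ltnS ?geq_minr.
  by apply: order_onS (subsetDl _ _) _; apply: order_on_le.
exact: (classification (valuation_of_measure nu)).
Qed.
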